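(* Let $n\ge 1$, let $K=\mathbb{F}_{2^n}$, let $f:K\to K$ be a quadratic APN function and let $g:K\to K$, $g(x)=x^{2^r+1}$, be a Gold function, where $r$ is a positive integer with $\gcd(r,n)=1$. If $f$ and $g$ are CCZ-equivalent, then they are EA-equivalent.
   Context: A function $f:K\to K$ is APN (almost perfect nonlinear) if for all $a,b\in K$ with $a\neq 0$ the equation $f(x+a)-f(x)=b$ has at most 2 solutions $x\in K$. A function $f:K\to K$ is quadratic if for every nonzero $k\in K$ the map $x\mapsto f(x+k)+f(x)+f(k)$ is $\mathbb{F}_2$-linear on $K$. ''Affine'' means affine over $\mathbb{F}_2$. Two functions $f,g:K\to K$ are EA-equivalent if there exist affine permutations $A_1,A_2$ of $K$ and an affine map $A:K\to K$ with $g=A_1\circ f\circ A_2+A$. They are CCZ-equivalent if there is an affine permutation of $K\times K$ mapping the graph $\{(x,f(x)) : x\in K\}$ onto the graph $\{(x,g(x)) : x\in K\}$. *)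

(* Defs.v *)
From HB Require Import structures.
From mathcomp Require Import all_boot all_order all_algebra all_field.

Set Implicit Arguments.
Unset Strict Implicit.
Unset Printing Implicit Defensive.

Import GRing.Theory.
Local Open Scope ring_scope.

(* F_(2^n) is modelled as a field extension K of 'F_2 of dimension n, so that *)
(* "F_2-linear" on K and on K * K is the library's [linear]. A [fieldExtType] *)
(* carries no canonical [finType] structure: [finvect_type K] is K itself     *)
(* with that structure added.                                                 *)

Definition affine (U V : lmodType 'F_2) (A : U -> V) : Prop :=
  exists (L : {linear U -> V}) (c : V), forall x, A x = L x + c.

Definition affine_permutation (U : lmodType 'F_2) (A : U -> U) : Prop :=
  affine A /\ bijective A.

Definition apn (K : fieldExtType 'F_2) (f : K -> K) : Prop :=
  forall a b : K, a != 0 ->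
    (#|[set x : finvect_type K | (f ((x : K) + a) - f x == b)%R]| <= 2)%N.

Definition quadratic (K : fieldExtType 'F_2) (f : K -> K) : Prop :=
  forall k : K, k != 0 -> linear (fun x : K => f (x + k) + f x + f k).

Definition gold (K : fieldExtType 'F_2) (r : nat) (x : K) : K :=
  x ^+ (2 ^ r + 1).

Definition EA_equivalent (K : fieldExtType 'F_2) (f g : K -> K) : Prop :=
  exists A1 A2 A : K -> K,
    [/\ affine_permutation A1, affine_permutation A2, affine A
      & forall x, g x = A1 (f (A2 x)) + A x].

Definition graph (K : fieldExtType 'F_2) (f : K -> K) :
    {set finvect_type K * finvect_type K} :=
  [set (x, f x : finvect_type K) | x : finvect_type K].

Definition CCZ_equivalent (K : fieldExtType 'F_2) (f g : K -> K) : Prop :=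
  exists P : K * K -> K * K,
    affine_permutation P /\
    (P : finvect_type K * finvect_type K -> finvect_type K * finvect_type K)
      @: graph f = graph g.

(* Main.v *)
Require Import Defs.
From HB Require Import structures.
From mathcomp Require Import all_boot all_order all_algebra all_field.
From mathcomp Require Import ring zify.

Set Implicit Arguments.
Unset Strict Implicit.
Unset Printing Implicit Defensive.

Import GRing.Theory.
Local Open Scope ring_scope.

(** The proof compares the two functions through affine maps of K * K that
    preserve the graph of the Gold function g. Write B for the polar form
    B(x, y) = g(x + y) + g(x) + g(y), and n for the dimension of K over F_2.

    If n <= 3, any two quadratic APN functions are EA-equivalent: the values of
    their polar forms on pairs of distinct basis vectors are linearly
    independent, so a linear bijection carries the polar form of f to B, and f
    and g differ by an additive map after that bijection ([EA_small_dim]).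

    If n >= 4, a CCZ-equivalence gives additive maps A, C, A', C' and constants
    such that pi(x) = A(x) + C(g(x)) + c1 is a permutation of K and
    f(pi(x)) = A'(x) + C'(g(x)) + c2 ([CCZ_blocks]); the equivalence is an
    EA-equivalence as soon as C = 0 ([EA_of_no_mixing]). So the task is to show
    that C = 0.

    The main tool is that a rank-one mixing term is impossible for n >= 4
    ([rank_one_gold_zero]): if N takes at most one nonzero value, if
    x |-> L(x) + N(g(x)) + c is injective and if a function h with an
    anisotropic polar form stays quadratic along that map, then N = 0.

    For n = 4, the components of a permutation are balanced, which forces every
    nonzero covector in the image of the transpose of C to be the inverse of a
    value of g. These are fifth roots of unity, and no two of them sum to a third, so C
    has rank at most one, and is 0 by the previous paragraph applied to f.

    For n >= 5, use that f is quadratic: the translation X |-> X + a extends to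
    an affine map of K * K preserving the graph of f. Carried over by pi, it
    becomes a permutation [trans a] of K of the form
    x |-> M(x) + N(g(x)) + s for which g(M(x) + N(g(x)) + s) is again an affine
    expression in x and g(x). Let phi(x) = x^(2^r), so that g(x) = x phi(x); as
    r is prime to n, every additive map is uniquely a sum of terms c_i phi^i
    with i modulo n. The vanishing of the fourth difference of g along
    [trans a] says that the vectors (u_i, phi(u_(i-1))) built from the
    coefficients u of N are proportional at any two non-adjacent indices, and
    this leaves only a single term c phi^s or a map of rank one
    ([monomial_or_rank_one]). A single term is bijective, but N has a nonzero
    kernel; rank one is excluded as above. Hence N = 0 ([mix_part_eq0]). Then M
    preserves B up to a linear map on the values, and the same analysis shows
    that M = c phi^s. Since M is an involution and M + id is additive in a, the
    elements a with M = id form a subgroup of index at most two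
    ([lin_part_index2]). For such a, [trans a] is an ordinary translation by
    some w, and then C(B(x, w)) = 0 for all x. These w are so many that
    C(B(x, y)) = 0 for all x and y, and therefore C = 0 ([no_mixing]). *)

(** * Additive maps and polar forms in characteristic 2 *)

Notation is_additive h := {morph h : x y / x + y}.

Definition polar (V : zmodType) (h : V -> V) (x y : V) : V :=
  h (x + y) + h x + h y.

Definition binary (V : pzRingType) (q : V -> V) : Prop :=
  forall x, q x = 0 \/ q x = 1.

(** For additive maps over F_2: the image has dimension at most one. *)
Definition rank_le1 (V : zmodType) (N : V -> V) : Prop :=
  forall x y, N x != 0 -> N y != 0 -> N x = N y.

Definition biadditive (V : zmodType) (B : V -> V -> V) : Prop :=
  (forall y, is_additive (B^~ y)) /\ (forall x, is_additive (B x)).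

(** For the polar form of a quadratic function this is the APN property. *)
Definition anisotropic (V : zmodType) (B : V -> V -> V) : Prop :=
  forall x y, B x y = 0 -> [\/ x = 0, y = 0 | x = y].

(** The signs are immaterial in characteristic 2; keeping them makes the
    vanishing on quadratic functions an identity over the integers. *)
Definition third_difference (V : zmodType) (h : V -> V) (x y z : V) : V :=
  h (x + y + z) - h (x + y) - h (x + z) - h (y + z) + h x + h y + h z - h 0.

Lemma F2_cases (a : 'F_2) : a = 0 \/ a = 1.
Proof. by case: a => [[|[|]]] // ?; [left | right]; apply: val_inj. Qed.

Section Char2.
Variable K : fieldExtType 'F_2.
Implicit Types (x y : K) (h : K -> K).

Lemma pchar2 : 2 \in [pchar K].
Proof. by rewrite pchar_lalg pchar_Fp. Qed.

Lemma addxx x : x + x = 0.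
Proof. exact: addrr_pchar2 pchar2 x. Qed.

Lemma oppx x : - x = x.
Proof. exact: oppr_pchar2 pchar2 x. Qed.

Lemma addxK x y : x + y + y = x.
Proof. by rewrite -addrA addxx addr0. Qed.

Lemma addx_eq0 x y : x + y = 0 -> x = y.
Proof. by move/eqP; rewrite addr_eq0 oppx => /eqP. Qed.

Lemma binaryD (u v : K) : u = 0 \/ u = 1 -> v = 0 \/ v = 1 ->
  u + v = 0 \/ u + v = 1.
Proof. by case=> ->; case=> ->; rewrite ?addxx ?addr0 ?add0r; auto. Qed.

Lemma add_polar h x y : h (x + y) = h x + h y + polar h x y.
Proof.
rewrite /polar; have -> : h x + h y + (h (x + y) + h x + h y) =
  h (x + y) + (h x + h x) + (h y + h y) by ring.
by rewrite !addxx !addr0.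
Qed.

Lemma polarC h x y : polar h x y = polar h y x.
Proof. by rewrite /polar addrC [x + y]addrC; ring. Qed.

Lemma additive0 h : is_additive h -> h 0 = 0.
Proof. by move=> hD; have := hD 0 0; rewrite addr0 addxx. Qed.

Lemma additive_scale h : is_additive h -> scalable h.
Proof.
by move=> hD a x; case: (F2_cases a) => ->; rewrite ?scale0r ?scale1r ?additive0.
Qed.

Lemma additive_sum h (I : finType) (F : I -> K) :
  is_additive h -> h (\sum_i F i) = \sum_i h (F i).
Proof. by move=> hD; apply: (big_morph h) => //; apply: additive0. Qed.

Lemma linear_of_additive h : is_additive h -> exists L : {linear K -> K}, L =1 h.
Proof.
move=> hD.
have hlin : linear h by move=> a x y; rewrite hD additive_scale.
pose hL : {linear K -> K} := HB.pack_for {linear K -> K} h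
  (GRing.isLinear.Build _ _ _ _ h hlin).
by exists hL.
Qed.

Lemma additive_inj h : is_additive h -> (forall x, h x = 0 -> x = 0) -> injective h.
Proof. by move=> hD h0 x y exy; apply/addx_eq0/h0; rewrite hD exy addxx. Qed.

Lemma biadditive_polar0 h : biadditive (polar h) -> h 0 = 0.
Proof.
move=> [bDl _]; have := additive0 (bDl 0).
by rewrite /polar addr0 addxx add0r.
Qed.

Lemma polarxx h x : biadditive (polar h) -> polar h x x = 0.
Proof. by move=> bB; rewrite /polar addxx (biadditive_polar0 bB) add0r addxx. Qed.

Lemma binary_polar h : binary h -> forall x, binary (polar h x).
Proof. by move=> h01 x y; rewrite /polar; do !apply: binaryD. Qed.

Lemma additive_vbasis_eq h h' : is_additive h -> is_additive h' ->
  (forall j, (j < \dim {:K})%N -> h (vbasis {:K})`_j = h' (vbasis {:K})`_j) ->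
  h =1 h'.
Proof.
move=> hD h'D ehh' x; rewrite (coord_vbasis (memvf x)).
rewrite (additive_sum _ hD) (additive_sum _ h'D); apply: eq_bigr => j _.
by rewrite (additive_scale hD) (additive_scale h'D) ehh'.
Qed.

End Char2.

Lemma quadratic_polar (K : fieldExtType 'F_2) (f : K -> K) :
  quadratic f -> biadditive (polar f).
Proof.
move=> fq.
have f0 : f 0 = 0.
  have [k k0] : exists k : K, k != 0 by exists 1; apply: oner_neq0.
  have := fq k k0 1 0 0; rewrite !scale1r !addr0 !add0r.
  by rewrite addxx addrAC addxx add0r.
have bl y : is_additive (polar f ^~ y).
  move=> u v /=; have [-> | y0] := eqVneq y 0.
    by rewrite /polar f0 !addr0 !addxx.
  by have := fq y y0 1 u v; rewrite !scale1r.
by split=> // x u v; rewrite polarC bl !(polarC _ x).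
Qed.

(** A third solution y of f(z + x) - f(z) = f(x), besides 0 and x, is the same
    thing as a zero of the polar form at a pair (x, y) of distinct nonzero
    elements. *)
Lemma apn_anisotropic (K : fieldExtType 'F_2) (f : K -> K) :
  quadratic f -> apn f -> anisotropic (polar f).
Proof.
move=> fq fapn x y; have f0 := biadditive_polar0 (quadratic_polar fq).
have [-> | x0] := eqVneq x 0; first by constructor 1.
have [-> | y0] := eqVneq y 0; first by constructor 2.
have [-> | xy] := eqVneq x y; first by constructor 3.
move=> Bxy; exfalso; have := fapn x (f x) x0; apply/negP; rewrite -ltnNge.
pose s := [set (0 : finvect_type K); x : finvect_type K; y : finvect_type K].
have s3 : #|s| = 3.
  by rewrite /s -setUA !cardsU1 cards1 !inE ![0 == _]eq_sym negb_or x0 y0 xy.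
rewrite -[2.+1]s3; apply: subset_leq_card; apply/subsetP=> z.
rewrite !inE => /orP[/orP[]|] /eqP->; apply/eqP.
- by rewrite add0r f0 subr0.
- by rewrite addxx f0 add0r oppx.
- by rewrite add_polar polarC Bxy addr0 addrAC subrr add0r.
Qed.

(** * Rank-one perturbations of additive maps *)

Section RankOne.
Variable K : fieldExtType 'F_2.
Let T := finvect_type K.

Lemma card_field : #|T| = (2 ^ \dim {:K})%N.
Proof.
have := @card_vspace 'F_2 T _ (fullv : {vspace T}).
by rewrite card_vspacef card_Fp.
Qed.

Lemma card_half_kernel (b : K -> K) (S : {set T}) :
  is_additive b -> binary b ->
  (forall x y : K, (x : T) \in S -> (y : T) \in S -> (x + y : T) \in S) ->
  (#|S| <= (#|[set x in S | (b x == 0)%R]|).*2)%N.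
Proof.
move=> bD b01 SD; set S0 := [set x in S | _].
have [Ssub | ] := boolP (S \subset S0).
  by rewrite -addnn (leq_trans (subset_leq_card Ssub)) ?leq_addr.
case/subsetPn=> s sS sS0.
have bs : b s = 1.
  by case: (b01 s) => // bs0; rewrite inE sS bs0 eqxx in sS0.
rewrite -(cardsID S0 S) -addnn leq_add //.
  by rewrite subset_leq_card ?subsetIr.
have inj_s : injective (fun x : T => (x : K) + s : T).
  by move=> x y /(congr1 (fun z : K => z + s)); rewrite /= !addxK.
rewrite -(card_imset (mem (S :\: S0)) inj_s); apply: subset_leq_card.
apply/subsetP=> _ /imsetP[x /setDP[xS xS0] ->].
have bx : b x = 1.
  by case: (b01 x) => // bx0; rewrite inE xS bx0 eqxx in xS0.
by rewrite inE SD //= bD bx bs addxx.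
Qed.

(** Along p(x) = L(x) + q(x) e + c, the cubic part of h is the product of q
    with l(x) = polar h (L x) e. If polar q x0 y0 = 1, the vanishing of its
    polarization forces l to be 0 on the orthogonal of x0 and y0, a set of at
    least 2^(n-2) elements. There L takes values in {0, e} because polar h is
    anisotropic, so p takes only two values, against injectivity when n >= 4. *)
Lemma rank_one_perturbation (h L q : K -> K) (e c : K) :
    (4 <= \dim {:K})%N ->
    biadditive (polar h) -> anisotropic (polar h) -> is_additive L ->
    e != 0 -> binary q -> biadditive (polar q) ->
    injective (fun x => L x + q x * e + c) ->
    (forall x y z,
       third_difference (fun x => h (L x + q x * e + c)) x y z = 0) ->
  forall x y, polar q x y = 0.
Proof.
move=> n4 hB han LD e0 q01 qB pinj pD3 x0 y0.
have [hBl hBr] := hB; have [qBl qBr] := qB.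
have q0 := biadditive_polar0 qB; have h0 := biadditive_polar0 hB.
pose l x := polar h (L x) e.
have lD : is_additive l by move=> x y; rewrite /l LD hBl.
have b01 := binary_polar q01.
have hp x : h (L x + q x * e + c) =
    h (L x) + polar h (L x) c + q x * (h e + l x + polar h e c) + h c.
  case: (q01 x) => ->; rewrite ?mul0r ?mul1r ?addr0 !(add_polar h) ?hBl /l; ring.
have key x y z : polar q x y * l z + polar q y z * l x + polar q x z * l y = 0.
  rewrite -(pD3 x y z) /third_difference !hp !lD !LD !(add_polar h) !(add_polar q) !hBl.
  rewrite q0 (additive0 LD) (additive0 lD) h0 (additive0 (hBl _)).
  rewrite !qBl; ring.
case: (b01 x0 y0) => // b1; exfalso.
pose S0 := [set: T]; pose S1 := [set x in S0 | polar q x0 x == 0].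
pose S2 := [set x in S1 | polar q y0 x == 0].
have c1 : (#|S0| <= (#|S1|).*2)%N.
  by apply: card_half_kernel => // x y; rewrite !inE.
have c2 : (#|S1| <= (#|S2|).*2)%N.
  apply: card_half_kernel => // x y; rewrite !inE /= => /eqP hx /eqP hy.
  by rewrite qBr hx hy addr0.
have c3 : (16 <= #|S0|)%N by rewrite cardsT card_field (@leq_exp2l 2 4).
suff : (#|S2| <= #|{: bool}|)%N by rewrite card_bool; lia.
have LS2 (z : T) : z \in S2 -> L z = 0 \/ L z = e.
  rewrite !inE /= => /andP[/eqP x0z /eqP y0z].
  have := key x0 y0 z; rewrite b1 x0z y0z !mul0r !addr0 mul1r => /han.
  by case=> [->|e00|->]; [left | rewrite e00 eqxx in e0 | right].
pose p (x : K) := L x + q x * e + c.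
apply: (@leq_card_in _ _ (fun z : T => p z == c)) => z w zS wS pzw.
apply: pinj; move: pzw; rewrite /= -/(p z) -/(p w).
have pc (v : T) : v \in S2 -> p v = c \/ p v = e + c.
  move/LS2; rewrite /p; case: (q01 v) => ->; case=> ->;
    rewrite ?mul0r ?mul1r ?addr0 ?addxx ?add0r; auto.
have ec : (e + c == c) = false.
  by apply: contraNF e0 => /eqP/(canRL (addrK _)) ->; rewrite subrr.
by case: (pc z zS) => ->; case: (pc w wS) => ->; rewrite ?eqxx ?ec.
Qed.

End RankOne.

(** * The Gold function and its underlying field automorphism *)

Section Frobenius.
Variables (K : fieldExtType 'F_2) (r : nat).
Implicit Types x y : K.

Definition frob (i : nat) (x : K) : K := x ^+ (2 ^ (r * i)).

Lemma frobD i : is_additive (frob i).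
Proof.
move=> x y; apply: exprDn_pchar.
by rewrite (eq_pnat _ (pcharf_eq (pchar2 K))) pnatX orTb.
Qed.

Lemma frobM i x y : frob i (x * y) = frob i x * frob i y.
Proof. exact: exprMn. Qed.

Lemma frob_0 x : frob 0 x = x.
Proof. by rewrite /frob muln0 expn0 expr1. Qed.

Lemma frob_add i j x : frob i (frob j x) = frob (i + j) x.
Proof. by rewrite /frob -exprM -expnD -mulnDr addnC. Qed.

Lemma frob_eq0 i x : (frob i x == 0) = (x == 0).
Proof. by rewrite /frob expf_eq0 expn_gt0. Qed.

Lemma expf_dim x : x ^+ (2 ^ \dim {:K}) = x.
Proof. by rewrite -card_field -[RHS](@expf_card (finvect_type K)). Qed.

Lemma expf_mod j x : x ^+ (2 ^ (j %% \dim {:K})) = x ^+ (2 ^ j).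
Proof.
rewrite [in RHS](divn_eq j (\dim {:K})).
elim: (j %/ _)%N => [|q IHq]; first by rewrite mul0n add0n.
by rewrite mulSn -addnA expnD exprM expf_dim.
Qed.

Lemma frob_mod i x : frob (i %% \dim {:K}) x = frob i x.
Proof. by rewrite /frob -expf_mod modnMmr expf_mod. Qed.

(** A fixed point of both x^(2^r) and x^(2^n) is fixed by squaring, by Bezout. *)
Lemma frob_fixed x :
  (0 < r)%N -> coprime r (\dim {:K}) -> frob 1 x = x -> x = 0 \/ x = 1.
Proof.
move=> r_gt0 co fx.
have fi i : frob i x = x.
  by elim: i => [|i IHi]; rewrite ?frob_0 // -(add1n i) -frob_add IHi.
have [k l Ekl _] := egcdnP (\dim {:K}) r_gt0.
have x2 : x ^+ 2 = x.
  rewrite -[RHS](fi k) /frob mulnC Ekl (eqP co) expnD exprM; congr (_ ^+ _).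
  elim: l {Ekl} => [|l IHl]; first by rewrite expr1.
  by rewrite mulSn expnD exprM expf_dim.
have /eqP : x * (x - 1) = 0 by rewrite mulrBr mulr1 -expr2 x2 subrr.
by rewrite mulf_eq0 subr_eq0 => /orP[] /eqP; auto.
Qed.

Lemma goldE x : gold r x = x * frob 1 x.
Proof. by rewrite /gold /frob muln1 addn1 exprS. Qed.

Lemma polar_gold x y : polar (gold r) x y = x * frob 1 y + frob 1 x * y.
Proof.
rewrite /polar !goldE frobD.
have -> : (x + y) * (frob 1 x + frob 1 y) + x * frob 1 x + y * frob 1 y =
  x * frob 1 y + frob 1 x * y + (x * frob 1 x + x * frob 1 x)
   + (y * frob 1 y + y * frob 1 y) by ring.
by rewrite !addxx !addr0.
Qed.

Lemma biadditive_gold : biadditive (polar (gold r : K -> K)).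
Proof.
by split=> [y|x] u v /=; rewrite !polar_gold frobD; ring.
Qed.

Lemma anisotropic_gold : (0 < r)%N ->
  coprime r (\dim {:K}) -> anisotropic (polar (gold r : K -> K)).
Proof.
move=> r_gt0 co x y; rewrite polar_gold => /addx_eq0 exy.
have [-> | y0] := eqVneq y 0; first by constructor 2.
have : frob 1 (x / y) = x / y.
  have fy0 : frob 1 y != 0 by rewrite frob_eq0.
  apply: (mulIf fy0); rewrite -frobM divfK // mulrAC exy mulfK //.
case/(frob_fixed r_gt0 co) => /(canRL (divfK y0)) ->; rewrite ?mul0r ?mul1r.
  by constructor 1.
by constructor 3.
Qed.

End Frobenius.

(** * Coefficients of additive maps over the powers of the automorphism *)

Section Coefficients.
Variables (m : nat) (K : fieldExtType 'F_2) (r : nat).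
Hypothesis dimK : \dim {:K} = m.+4.
Hypothesis co_r : coprime r m.+4.
Local Notation n := m.+4.
Local Notation phi := (frob (K := K) r).
Implicit Types (i j k : 'I_n) (x y : K) (h : K -> K).

Definition basis_vec (j : nat) : K := (vbasis {:K})`_j.

Lemma additive_basis h h' : is_additive h -> is_additive h' ->
  (forall j : 'I_n, h (basis_vec j) = h' (basis_vec j)) -> h =1 h'.
Proof.
move=> hD h'D ehh'; apply: additive_vbasis_eq => // j lt_j.
have lt_jn : (j < n)%N by rewrite -dimK.
exact: ehh' (Ordinal lt_jn).
Qed.

Lemma additive_frob_sum (c : 'I_n -> K) : is_additive (fun x => \sum_i c i * phi i x).
Proof.
by move=> x y; rewrite -big_split; apply: eq_bigr => i _; rewrite frobD mulrDr.
Qed.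

(** After reducing the exponents r i modulo n, which is injective on i < n, the
    sum becomes a polynomial of degree at most 2^(n-1) that vanishes on all the
    2^n elements of K. *)
Lemma frob_independent (c : 'I_n -> K) :
  (forall x, \sum_i c i * phi i x = 0) -> forall i, c i = 0.
Proof.
move=> c0 i.
pose ex (k : 'I_n) := (2 ^ ((r * k) %% n))%N.
pose p := \sum_k c k *: 'X^(ex k) : {poly K}.
have ex_inj : injective ex.
  move=> k l /eqP; rewrite eqn_exp2l // => /eqP ekl; apply: val_inj => /=.
  wlog lkl : k l ekl / (l <= k)%N.
    by move=> H; case: (leqP l k) => [|/ltnW] /H -> //.
  have: (n %| r * (k - l))%N.
    by rewrite mulnBr -eqn_mod_dvd ?leq_mul // ekl eqxx.
  rewrite Gauss_dvdr 1?coprime_sym // => /dvdnP[[|q]].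
    by move/eqP; rewrite subn_eq0 => kl; apply/eqP; rewrite eqn_leq kl.
  by have := ltn_ord k; rewrite mulSn; lia.
have szp : (size p <= 2 ^ n)%N.
  apply/leq_sizeP => k lek; rewrite coef_sum big1 // => l _.
  rewrite coefZ coefXn; case: eqP => [ekl|_]; last by rewrite mulr0.
  by move: lek; rewrite ekl leqNgt ltn_exp2l // ltn_mod.
have p0 : p = 0.
  apply/eqP; apply: contraTT szp => pn0; rewrite -ltnNge.
  have := max_poly_roots pn0 (rs := enum (finvect_type K)).
  rewrite -cardE card_field dimK; apply; last exact: enum_uniq.
  apply/allP=> x _; apply/rootP.
  rewrite horner_sum -[RHS](c0 x); apply: eq_bigr => k _.
  rewrite hornerZ hornerXn /ex.
  by have := expf_mod (r * k) x; rewrite dimK => ->.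
have := congr1 (fun q : {poly K} => q`_(ex i)) p0.
rewrite coef_sum (bigD1 i) //= big1 => [|k ki].
  by rewrite coefZ coefXn eqxx mulr1 addr0 coef0.
by rewrite coefZ coefXn (inj_eq ex_inj) eq_sym (negPf ki) mulr0.
Qed.

(** The Moore matrix of a basis; its inverse reads the coefficients of an
    additive map off its values on the basis. *)
Definition moore : 'M[K]_n := \matrix_(i, j) phi i (basis_vec j).

Lemma moore_unit : moore \in unitmx.
Proof.
rewrite -row_free_unit; apply: inj_row_free => v vM.
apply/rowP=> i; rewrite mxE; apply: (frob_independent (c := v 0)) => x.
apply: (additive_basis (additive_frob_sum _) (h' := fun=> 0)) => [? ? | j].
  by rewrite addr0.
move/rowP/(_ j): vM; rewrite !mxE => vM; rewrite -[RHS]vM.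
by apply: eq_bigr => k _; rewrite mxE.
Qed.

(** The coefficient of phi^i in h. Being given by a formula that is linear in h,
    it can be taken in one variable of a multiadditive expression while the
    other variables stay as parameters. *)
Definition fcoef h i : K := ((\row_j h (basis_vec j)) *m invmx moore) 0 i.

Lemma fcoef_ext h h' i : h =1 h' -> fcoef h i = fcoef h' i.
Proof.
by move=> eh; congr ((_ *m _) 0 i); apply/rowP=> j; rewrite !mxE eh.
Qed.

Lemma fcoefE h i : fcoef h i = \sum_(j < n) h (basis_vec j) * invmx moore j i.
Proof. by rewrite /fcoef mxE; apply: eq_bigr => j _; rewrite mxE. Qed.

Lemma fcoef_sum (I : finType) (F : I -> K -> K) i :
  fcoef (fun x => \sum_k F k x) i = \sum_k fcoef (F k) i.
Proof.
rewrite fcoefE (eq_bigr _ (fun j _ => mulr_suml _ _ _ _)) exchange_big /=.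
by apply: eq_bigr => k _; rewrite fcoefE.
Qed.

Lemma fcoefD h h' i : fcoef (fun x => h x + h' x) i = fcoef h i + fcoef h' i.
Proof.
by rewrite !fcoefE -big_split; apply: eq_bigr => j _; rewrite mulrDl.
Qed.

Lemma fcoefMl h a i : fcoef (fun x => a * h x) i = a * fcoef h i.
Proof.
by rewrite !fcoefE mulr_sumr; apply: eq_bigr => j _; rewrite mulrA.
Qed.

Lemma fcoefMr h a i : fcoef (fun x => h x * a) i = fcoef h i * a.
Proof. by rewrite mulrC -fcoefMl; apply: fcoef_ext => x; rewrite mulrC. Qed.

Lemma fcoef0 i : fcoef (fun=> 0) i = 0.
Proof. by rewrite fcoefE big1 // => j _; rewrite mul0r. Qed.

Lemma fcoef_frob i j : fcoef (phi j) i = (i == j)%:R.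
Proof.
rewrite /fcoef (_ : \row_k _ = row j moore); last by apply/rowP=> k; rewrite !mxE.
by rewrite -row_mul mulmxV ?moore_unit // !mxE eq_sym.
Qed.

Lemma fcoef_expand h : is_additive h -> forall x, h x = \sum_i fcoef h i * phi i x.
Proof.
move=> hD; apply: (additive_basis hD (additive_frob_sum _)) => j.
have := congr1 (fun M : 'rV_n => M 0 j)
  (mulmxKV moore_unit (\row_j h (basis_vec j))).
rewrite !mxE => <-; by apply: eq_bigr => i _; congr (_ * _); rewrite mxE.
Qed.

Lemma fcoef_frob_sum (c : 'I_n -> K) i :
  fcoef (fun x => \sum_k c k * phi k x) i = c i.
Proof.
rewrite fcoef_sum (bigD1 i) //= big1 => [|k ki].
  by rewrite fcoefMl fcoef_frob eqxx mulr1 addr0.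
by rewrite fcoefMl fcoef_frob eq_sym (negPf ki) mulr0.
Qed.

End Coefficients.

(** * Additive maps of the values of the polar form *)

Section GoldCoefficients.
Variables (m : nat) (K : fieldExtType 'F_2) (r : nat).
Hypothesis dimK : \dim {:K} = m.+4.
Hypothesis co_r : coprime r m.+4.
Local Notation n := m.+4.
Local Notation phi := (frob (K := K) r).
Local Notation g := (gold r : K -> K).
Local Notation fcoef := (@fcoef m K r).
Implicit Types (i j k s t : 'I_n) (x y : K) (h N : K -> K).

Lemma index_shift i k : (0 < k < n)%N -> (i == i + k%:R) = false.
Proof.
case/andP=> k_gt0 k_lt; apply/negP=> /eqP/(canLR (addKr i)); rewrite addNr => /esym.
by move/(congr1 val); rewrite Zp_nat /= modn_small // => k0; rewrite k0 in k_gt0.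
Qed.

Lemma frobS i x : phi 1 (phi i x) = phi (i + 1 : 'I_n)%R x.
Proof. by rewrite frob_add /= -frob_mod dimK modnDmr addnC. Qed.

Lemma sum_delta (F : 'I_n -> K) i : \sum_k F k * (i == k)%:R = F i.
Proof.
rewrite (bigD1 i) //= eqxx mulr1 big1 ?addr0 // => k ki.
by rewrite eq_sym (negPf ki) mulr0.
Qed.

Lemma fcoef_frob_comp h i :
  is_additive h -> fcoef (fun x => phi 1 (h x)) i = phi 1 (fcoef h (i - 1)).
Proof.
move=> hD; rewrite -[RHS](fcoef_frob_sum dimK co_r (fun k => phi 1 (fcoef h (k - 1)))).
apply: fcoef_ext => x.
rewrite (fcoef_expand dimK co_r hD) additive_sum; last exact: frobD.
rewrite [RHS](reindex_inj (addIr 1)) /=; apply: eq_bigr => k _.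
by rewrite addrK frobM frobS.
Qed.

Lemma fcoef_polar_gold N i y : is_additive N ->
  fcoef (fun x => N (polar g x y)) i =
  fcoef N i * phi (i + 1 : 'I_n)%R y + fcoef N (i - 1) * phi (i - 1 : 'I_n)%R y.
Proof.
move=> ND.
have E x : N (polar g x y) = \sum_k
    (fcoef N k * phi (k + 1 : 'I_n)%R y * phi k x +
     fcoef N k * phi k y * phi (k + 1 : 'I_n)%R x).
  rewrite (fcoef_expand dimK co_r ND); apply: eq_bigr => k _.
  rewrite polar_gold frobD !frobM mulrDr ![phi k (phi 1 _)]frob_add.
  by rewrite ![(k + 1)%N]addnC -!frob_add !(frobS k) ![phi _ x * _]mulrC !mulrA.
rewrite (fcoef_ext r i E) fcoef_sum.
rewrite -(sum_delta (fun k => fcoef N k * phi (k + 1 : 'I_n)%R y) i).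
rewrite -(sum_delta (fun k => fcoef N k * phi k y) (i - 1)) -big_split.
apply: eq_bigr => k _.
by rewrite fcoefD !fcoefMl !fcoef_frob // subr_eq.
Qed.

(** Every monomial of N (polar g x y) has adjacent exponents in x and y, and the
    coefficient of phi^i(x) phi^(i+1)(y) is that of phi^i in N: as n >= 3, the
    two terms on the right are never nonzero together. *)
Lemma fcoef2_polar_gold N i j : is_additive N ->
  fcoef (fun x => fcoef (fun y => N (polar g x y)) j) i =
  fcoef N i * (j == i + 1)%:R + fcoef N j * (i == j + 1)%:R.
Proof.
move=> ND.
have E1 x : fcoef (fun y => N (polar g x y)) j =
    fcoef N j * phi (j + 1 : 'I_n)%R x + fcoef N (j - 1) * phi (j - 1 : 'I_n)%R x.
  by rewrite -(fcoef_polar_gold j x ND); apply: fcoef_ext => y; rewrite polarC.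
rewrite (fcoef_ext r i E1) fcoefD !fcoefMl !fcoef_frob // addrC; congr (_ + _).
rewrite [i == _]eq_sym subr_eq; case: eqP => [-> | _]; first by rewrite addrK.
by rewrite !mulr0.
Qed.

Lemma polar_gold_separates N : is_additive N ->
  (forall x y, N (polar g x y) = 0) -> forall x, N x = 0.
Proof.
move=> ND N0 x; rewrite (fcoef_expand dimK co_r ND) big1 // => i _.
suff -> : fcoef N i = 0 by rewrite mul0r.
have := fcoef2_polar_gold i (i + 1) ND.
rewrite eqxx mulr1 (_ : i == i + 1 + 1 = false).
  rewrite mulr0 addr0 => <-; rewrite -[RHS](fcoef0 K r i); apply: fcoef_ext => u.
  by rewrite -[RHS](fcoef0 K r (i + 1)); apply: fcoef_ext => v.
by rewrite -addrA (index_shift _ (k := 2)).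
Qed.

End GoldCoefficients.

(** * Coefficients that are proportional at non-adjacent indices *)

Section StructureLemma.
Variables (m : nat) (K : fieldExtType 'F_2) (r : nat).
Hypothesis m_gt0 : (0 < m)%N.
Local Notation n := m.+4.
Local Notation phi := (frob (K := K) r).
Implicit Types i k s t : 'I_n.

(** The plane vectors (u_s, phi(u_(s-1))) and (u_t, phi(u_(t-1))) have zero
    determinant when s and t are not adjacent in the cycle Z/n. *)
Definition frob_nonadjacent_parallel (u : 'I_n -> K) : Prop :=
  forall s t, s != t -> s != t + 1 -> t != s + 1 ->
     u s * phi 1 (u (t - 1)) = u t * phi 1 (u (s - 1)).

Lemma index_eq i (k l : nat) : (k < 5)%N -> (l < 5)%N ->
  (i + k%:R == i + l%:R) = (k == l).
Proof.
move=> k5 l5; rewrite (inj_eq (addrI i)) -val_eqE /= !Zp_nat /= !modn_small //.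
all: lia.
Qed.

(** If all u_s are nonzero, the ratios u_s / phi(u_(s-1)) agree at non-adjacent
    indices, and for n >= 5 the complement of the n-cycle is connected.
    Otherwise, if u is not 0, some run of nonzero coefficients starts at an
    index s + 2, that is, u_(s+1) = 0; comparing with s + 2 kills all
    coefficients except those at s and s + 2, and comparing s with s + 3 kills
    the one at s. *)
Lemma sparse_or_geometric (u : 'I_n -> K) :
  frob_nonadjacent_parallel u ->
  (exists s, forall k, k != s -> u k = 0) \/
  (exists c, forall s, u s = c * phi 1 (u (s - 1))).
Proof.
move=> uD.
have neq (i : 'I_n) (k l : nat) : (k < 5)%N -> (l < 5)%N -> k != l ->
  i + k%:R != i + l%:R by move=> k5 l5; rewrite index_eq.
have [/forallP u_neq0 | ] := boolP [forall s, u s != 0].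
  right; pose c s := u s / phi 1 (u (s - 1)).
  have v_neq0 s : phi 1 (u (s - 1)) != 0 by rewrite frob_eq0.
  have cE s t : s != t -> s != t + 1 -> t != s + 1 -> c s = c t.
    move=> st st1 ts1; apply/eqP; rewrite /c eqr_div //.
    by rewrite uD // mulrC [X in _ == X]mulrC.
  have c_step s : c s = c (s + 1).
    transitivity (c (s + 3%:R)).
      apply: cE; [have := @neq s 0 3 | have := @neq s 0 4 | have := @neq s 3 1].
      + by rewrite addr0; apply.
      + by rewrite addr0 -addrA; apply.
      + by apply.
    apply/esym/cE; [have := @neq s 1 3 | have := @neq s 1 4 | have := @neq s 3 2].
    + by apply.
    + by rewrite -addrA; apply.
    + by rewrite -addrA; apply.
  exists (c 0) => s; have -> : c 0 = c s.
    rewrite -[s]natr_Zp; elim: (nat_of_ord s) => // k IHk.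
    by rewrite -natr1 -c_step.
  by rewrite /c divfK.
rewrite negb_forall => /existsP[b]; rewrite negbK => /eqP ub; left.
have [/forallP u_eq0 | ] := boolP [forall s, u s == 0].
  by exists 0 => k _; apply/eqP.
rewrite negb_forall => /existsP[a ua].
have [s us us1] : exists2 s, u (s + 2%:R) != 0 & u (s + 1) = 0.
  have [/existsP[s /andP[us /eqP us1]] | ] :=
    boolP [exists s, (u (s + 2%:R) != 0) && (u (s + 1) == 0)]; first by exists s.
  rewrite negb_exists => /forallP allu; exfalso.
  have us s : u s != 0 -> u (s - 1) != 0.
    have := allu (s - 2%:R); rewrite subrK negb_and negbK.
    have -> : s - 2%:R + 1 = s - 1 by rewrite -[2%:R]/(1 + 1) opprD addrA subrK.
    by case/orP => // /eqP ->; rewrite eqxx.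
  have uk (k : nat) : u (a - k%:R) != 0.
    by elim: k => [|k IHk]; rewrite ?subr0 // -natr1 opprD addrA us.
  by have := uk (a - b : 'I_n); rewrite natr_Zp opprB addrC subrK ub eqxx.
have u0 k : k != s -> k != s + 2%:R -> u k = 0.
  move=> ks ks2; have [-> // | ks1] := eqVneq k (s + 1).
  have := uD (s + 2%:R) (k + 1).
  rewrite addrK (_ : s + 2%:R - 1 = s + 1); last by rewrite mulrSr addrA addrK.
  rewrite us1 (additive0 (frobD _ _)) mulr0 => /(_ _ _ _)/eqP.
  rewrite mulf_eq0 (negPf us) /= frob_eq0 => H; apply/eqP/H.
  - by rewrite mulrSr addrA (inj_eq (addIr _)) eq_sym.
  - by rewrite mulrSr addrA !(inj_eq (addIr _)) eq_sym.
  by rewrite (inj_eq (addIr 1)).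
exists (s + 2%:R) => k ks2; have [-> {k ks2} | ks] := eqVneq k s; last exact: u0.
have := uD s (s + 3%:R); rewrite (u0 (s + 3%:R)) ?mul0r; last first.
- by apply: (@neq s 3 2).
- by have := @neq s 3 0; rewrite addr0; apply.
rewrite (_ : s + 3%:R - 1 = s + 2%:R); last by rewrite mulrSr addrA addrK.
move=> H; apply/eqP; have /eqP : u s * phi 1 (u (s + 2%:R)) = 0.
  apply: H.
  - by have := @neq s 0 3; rewrite addr0; apply.
  - by have := @neq s 0 4; rewrite addr0 -addrA; apply.
  - by apply: (@neq s 3 1).
by rewrite mulf_eq0 frob_eq0 (negPf us) orbF.
Qed.

End StructureLemma.

Section GoldStructure.
Variables (m : nat) (K : fieldExtType 'F_2) (r : nat).
Hypothesis dimK : \dim {:K} = m.+4.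
Hypothesis r_gt0 : (0 < r)%N.
Hypothesis co_r : coprime r m.+4.
Hypothesis m_gt0 : (0 < m)%N.
Local Notation n := m.+4.
Local Notation phi := (frob (K := K) r).
Local Notation g := (gold r : K -> K).
Local Notation fcoef := (@fcoef m K r).
Implicit Types (i j k s t : 'I_n) (x y : K) (h N : K -> K).

(** In the geometric case u_s = c phi(u_(s-1)), every value v of N satisfies
    v = c phi(v); the quotient of two nonzero values is fixed by phi, so it is
    1. *)
Lemma monomial_or_rank_one N : is_additive N ->
  frob_nonadjacent_parallel r (fcoef N) ->
  (exists s c, forall x, N x = c * phi s x) \/ rank_le1 N.
Proof.
move=> ND /(sparse_or_geometric m_gt0) [[s sp]|[c geo]].
  left; exists s, (fcoef N s) => x.
  rewrite (fcoef_expand dimK co_r ND) (bigD1 s) //= big1 ?addr0 // => k ks.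
  by rewrite sp // mul0r.
right.
have Nfix x : N x = c * phi 1 (N x).
  rewrite (fcoef_expand dimK co_r ND) additive_sum; last exact: frobD.
  rewrite mulr_sumr [LHS](reindex_inj (addIr 1)); apply: eq_bigr => k _.
  by rewrite geo addrK frobM (frobS r dimK) mulrA.
move=> x y Nx0 Ny0.
have c0 : c != 0 by apply: contraNneq Nx0 => c0; rewrite Nfix c0 mul0r.
have : phi 1 (N x / N y) = N x / N y.
  have phiNy0 : phi 1 (N y) != 0 by rewrite frob_eq0.
  apply: (mulIf phiNy0); rewrite -frobM divfK // [in RHS]Nfix [in X in _ / X]Nfix.
  by rewrite invfM !mulrA [c * _ / c]mulrAC divff // mul1r divfK.
have co_dim : coprime r (\dim {:K}) by rewrite dimK.
case/(frob_fixed r_gt0 co_dim) => /(canRL (divfK Ny0)).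
  by rewrite mul0r => /eqP; rewrite (negPf Nx0).
by rewrite mul1r.
Qed.

(** Compare the coefficients of phi^s(x) phi^t(y): on the right-hand side there
    is none when s and t are not adjacent. *)
Lemma polar_gold_image_parallel M S : is_additive M -> is_additive S ->
  (forall x y, polar g (M x) (M y) = S (polar g x y)) ->
  frob_nonadjacent_parallel r (fcoef M).
Proof.
move=> MD SD MS s t st st1 ts1; apply: addx_eq0.
have := fcoef2_polar_gold dimK co_r s t SD.
rewrite (negPf ts1) (negPf st1) !mulr0 addr0 => <-.
rewrite -!(fcoef_frob_comp dimK co_r _ MD).
have E x : fcoef (fun y => S (polar g x y)) t =
    M x * fcoef (fun y => phi 1 (M y)) t + phi 1 (M x) * fcoef M t.
  rewrite -(fcoefMl r M) -(fcoefMl r (fun y => phi 1 (M y))) -fcoefD.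
  by apply: fcoef_ext => y; rewrite -MS polar_gold.
rewrite (fcoef_ext r s E) fcoefD !fcoefMr; ring.
Qed.

Definition fcoef2 (h : K -> K -> K) i j := fcoef (fun x => fcoef (h x) j) i.

Lemma fcoef2_pairings (h h' : K -> K -> K) i j k l :
  (forall x y z w, h x y * h' z w + h' x y * h z w + (h x z * h' y w +
     h' x z * h y w) + (h x w * h' y z + h' x w * h y z) = 0) ->
  fcoef2 h i j * fcoef2 h' k l + fcoef2 h' i j * fcoef2 h k l +
  (fcoef2 h i k * fcoef2 h' j l + fcoef2 h' i k * fcoef2 h j l) +
  (fcoef2 h i l * fcoef2 h' j k + fcoef2 h' i l * fcoef2 h j k) = 0.
Proof.
move=> T0.
have Ew x y z : h x y * fcoef (h' z) l + h' x y * fcoef (h z) l +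
   (h x z * fcoef (h' y) l + h' x z * fcoef (h y) l) +
   (fcoef (h x) l * h' y z + fcoef (h' x) l * h y z) = 0.
  rewrite -[RHS](fcoef0 K r l) -(fcoef_ext r l (T0 x y z)).
  by rewrite !fcoefD !fcoefMl !fcoefMr.
have Ez x y : h x y * fcoef2 h' k l + h' x y * fcoef2 h k l +
   (fcoef (h x) k * fcoef (h' y) l + fcoef (h' x) k * fcoef (h y) l) +
   (fcoef (h x) l * fcoef (h' y) k + fcoef (h' x) l * fcoef (h y) k) = 0.
  rewrite -[RHS](fcoef0 K r k) -(fcoef_ext r k (Ew x y)).
  by rewrite !fcoefD !fcoefMr !fcoefMl.
have Ey x : fcoef (h x) j * fcoef2 h' k l + fcoef (h' x) j * fcoef2 h k l +
   (fcoef (h x) k * fcoef2 h' j l + fcoef (h' x) k * fcoef2 h j l) +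
   (fcoef (h x) l * fcoef2 h' j k + fcoef (h' x) l * fcoef2 h j k) = 0.
  rewrite -[RHS](fcoef0 K r j) -(fcoef_ext r j (Ez x)).
  by rewrite !fcoefD !fcoefMr !fcoefMl.
rewrite -[RHS](fcoef0 K r i) -(fcoef_ext r i Ey).
by rewrite !fcoefD !fcoefMr.
Qed.

(** Compare the coefficients of phi^s(x) phi^(s+1)(y) phi^t(z) phi^(t+1)(w). With
    s and t non-adjacent, the pairing (xz)(yw) does not contribute, and the
    pairing (xw)(yz) would need both t + 2 = s and s + 2 = t, that is, 4 = 0 in
    Z/n. *)
Lemma quartic_parallel N : is_additive N ->
  (forall x y z w, polar g (N (polar g x y)) (N (polar g z w)) +
    polar g (N (polar g x z)) (N (polar g y w)) +
    polar g (N (polar g x w)) (N (polar g y z)) = 0) ->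
  frob_nonadjacent_parallel r (fcoef N).
Proof.
move=> ND NQ s t st st1 ts1; apply: addx_eq0.
pose h x y := N (polar g x y); pose h' x y := phi 1 (N (polar g x y)).
have N'D : is_additive (fun x => phi 1 (N x)) by move=> x y; rewrite ND frobD.
have hE i j : fcoef2 h i j = _ := fcoef2_polar_gold dimK co_r i j ND.
have h'E i j : fcoef2 h' i j = _ := fcoef2_polar_gold dimK co_r i j N'D.
have NQ' x y z w : h x y * h' z w + h' x y * h z w + (h x z * h' y w +
     h' x z * h y w) + (h x w * h' y z + h' x w * h y z) = 0.
  by rewrite -(NQ x y z w) !(polar_gold r (N _)).
have := fcoef2_pairings s (s + 1) t (t + 1) NQ'.
have neq (i : 'I_n) (k l : nat) : (k < 5)%N -> (l < 5)%N -> k != l ->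
  (i + k%:R == i + l%:R) = false.
  by move=> k5 l5 kl; rewrite index_eq // (negPf kl).
rewrite !{}hE !{}h'E !eqxx !mulr1.
have sh i : (i == i + 1 + 1) = false.
  by have := neq i 0 2; rewrite addr0 -addrA; apply.
rewrite !sh (negPf ts1) (negPf st1) !(inj_eq (addIr 1)) ![t == s]eq_sym (negPf st).
rewrite ?(mulr0, mul0r, addr0, add0r).
have far : (s == t + 1 + 1)%:R * (t == s + 1 + 1)%:R = 0 :> K.
  have [-> | _] := eqVneq t (s + 1 + 1); last by rewrite mulr0.
  by have := neq s 0 4; rewrite addr0 -!addrA => ->; rewrite ?mul0r.
rewrite !(mulrACA _ (s == _)%:R) far !mulr0 !addr0.
by rewrite !(fcoef_frob_comp dimK co_r _ ND) [X in _ + X]mulrC.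
Qed.

End GoldStructure.

(** * Affine maps that preserve the graph of the Gold function *)

Section GoldAutomorphism.
Variables (K : fieldExtType 'F_2) (r : nat).
Local Notation g := (gold r : K -> K).
Variables (M N R S : K -> K) (c d : K).
Hypotheses (MD : is_additive M) (ND : is_additive N).
Hypotheses (RD : is_additive R) (SD : is_additive S).
Hypothesis aut : forall x, g (M x + N (g x) + c) = R x + S (g x) + d.

(** Take the fourth difference of the two sides of [aut]. The right-hand side is
    quadratic. On the left, g(p) = p phi(p), and by inclusion-exclusion only the
    products of a value of p at one pair of variables with the value of phi(p)
    at the complementary pair survive. *)
Lemma gold_automorphism_quartic x y z w :
  polar g (N (polar g x y)) (N (polar g z w)) +
  polar g (N (polar g x z)) (N (polar g y w)) +
  polar g (N (polar g x w)) (N (polar g y z)) = 0.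
Proof.
have [gBl gBr] := biadditive_gold K r.
have g0 := biadditive_polar0 (biadditive_gold K r).
pose fourth_difference (h : K -> K) :=
  h (x + y + z + w) - h (x + y + z) - h (x + y + w) - h (x + z + w)
  - h (y + z + w) + h (x + y) + h (x + z) + h (x + w) + h (y + z) + h (y + w)
  + h (z + w) - h x - h y - h z - h w + h 0.
have : fourth_difference (fun u => R u + S (g u) + d) = 0.
  rewrite /fourth_difference /= !RD !(add_polar g) !gBl !SD.
  by rewrite g0 (additive0 RD) (additive0 SD); ring.
have -> : fourth_difference (fun u => R u + S (g u) + d) =
    fourth_difference (fun u => (M u + N (g u) + c) * frob r 1 (M u + N (g u) + c)).
  by rewrite /fourth_difference -!goldE !aut.
move=> <-; rewrite /fourth_difference /=.
rewrite g0 (additive0 MD) (additive0 ND) !(polar_gold r (N _)).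
(* With polar g opaque, the goal is an identity over the integers. *)
have gD := add_polar g; move: (polar g) gBl gD => B BDl gD.
rewrite !MD !gD !BDl !ND !frobD !(additive0 (frobD r 1)); ring.
Qed.

Lemma gold_automorphism_polar x y : (forall u, N u = 0) ->
  polar g (M x) (M y) = S (polar g x y).
Proof.
move=> N0; have [gBl gBr] := biadditive_gold K r.
have g0 := biadditive_polar0 (biadditive_gold K r).
have autM u : g (M u + c) = R u + S (g u) + d by rewrite -aut N0 addr0.
have := autM (x + y); rewrite MD RD.
have gD := add_polar g; move: (polar g) gBl gD => B BDl gD; rewrite !gD BDl !SD.
have := autM x; have := autM y; have := autM 0.
rewrite !gD g0 (additive0 MD) (additive0 RD) (additive0 SD) g0 (additive0 (BDl c)).
move=> e0 ey ex exy; apply/eqP; rewrite -subr_eq0; apply/eqP.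
transitivity ((g (M x) + g (M y) + B (M x) (M y) + g c + (B (M x) c + B (M y) c)
   - (R x + R y + (S (g x) + S (g y) + S (B x y)) + d))
  - (g (M x) + g c + B (M x) c - (R x + S (g x) + d))
  - (g (M y) + g c + B (M y) c - (R y + S (g y) + d))
  + (0 + g c + 0 - (0 + 0 + d))); first by ring.
by rewrite exy ex ey e0 !subrr addr0.
Qed.

Lemma quadratic_third_difference x y z :
  third_difference (fun u => R u + S (g u) + d) x y z = 0.
Proof.
have [gBl gBr] := biadditive_gold K r.
have g0 := biadditive_polar0 (biadditive_gold K r).
rewrite /third_difference !RD !(add_polar g) !gBl !SD.
rewrite g0 (additive0 RD) (additive0 SD); ring.
Qed.

End GoldAutomorphism.

(** * Mixing terms of rank at most one *)

Section GoldRankOne.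
Variables (m : nat) (K : fieldExtType 'F_2) (r : nat).
Hypothesis dimK : \dim {:K} = m.+4.
Hypothesis co_r : coprime r m.+4.
Local Notation g := (gold r : K -> K).
Local Notation T := (finvect_type K).

Lemma rank_one_gold_zero (h L N : K -> K) (c : K) :
    biadditive (polar h) -> anisotropic (polar h) ->
    is_additive L -> is_additive N ->
    rank_le1 N ->
    injective (fun x => L x + N (g x) + c) ->
    (forall x y z,
       third_difference (fun x => h (L x + N (g x) + c)) x y z = 0) ->
  forall x, N x = 0.
Proof.
move=> hB han LD ND N1 pinj pD3.
have [/existsP[y0 Ny0] | ] := boolP [exists y : T, N y != 0]; last first.
  by rewrite negb_exists => /forallP N0 x; apply/eqP; rewrite -[_ == _]negbK.
pose q x := N (g x) / N y0.
have q01 : binary q.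
  move=> x.
  rewrite /q; have [-> | Nx0] := eqVneq (N (g x)) 0; first by left; rewrite mul0r.
  by right; rewrite (N1 _ _ Nx0 Ny0) divff.
have qN x : q x * N y0 = N (g x) by rewrite divfK.
have qP x y : polar q x y = N (polar g x y) / N y0.
  by rewrite /polar !ND !mulrDl.
have qB : biadditive (polar q).
  have [gBl gBr] := biadditive_gold K r.
  by split=> [y|x] u v /=; rewrite !qP ?gBl ?gBr ND mulrDl.
apply: (polar_gold_separates dimK co_r ND) => x y.
have := @rank_one_perturbation K h L q (N y0) c.
rewrite dimK => /(_ isT hB han LD Ny0 q01 qB) Hq.
have : polar q x y = 0.
  apply: Hq => [u v /= | u v w].
    by rewrite !qN => /pinj.
  by rewrite -[RHS](pD3 u v w) /third_difference !qN.
by rewrite qP => /eqP; rewrite mulf_eq0 invr_eq0 (negPf Ny0) orbF => /eqP.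
Qed.

End GoldRankOne.

(** * Balanced components *)

Section Balanced.
Variable K : fieldExtType 'F_2.
Local Notation T := (finvect_type K).

Definition sign_char (v : K) : int := if v == 0 then 1 else - 1.

Lemma sign_charD (u v : K) : u = 0 \/ u = 1 -> v = 0 \/ v = 1 ->
  sign_char (u + v) = sign_char u * sign_char v.
Proof.
rewrite /sign_char; case=> ->; case=> ->;
  by rewrite ?addr0 ?add0r ?addxx ?eqxx ?oner_eq0.
Qed.

Lemma sum_sign_char_additive (b : K -> K) (x0 : K) :
  is_additive b -> binary b -> b x0 != 0 -> \sum_(x : T) sign_char (b x) = 0.
Proof.
move=> bD b01 bx0; set S := \sum_x _.
have : S = - S.
  rewrite {1}/S (reindex_inj (addrI (x0 : T))) /= -sumrN; apply: eq_bigr => x _.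
  by rewrite bD sign_charD // {1}/sign_char (negPf bx0) mulN1r.
lia.
Qed.

(** If the polar form of q were nondegenerate, the square of the sum would be
    the number of elements of K. *)
Lemma sum_sign_char_quadratic (q : K -> K) :
  binary q -> biadditive (polar q) -> \sum_(x : T) sign_char (q x) = 0 ->
  exists2 u, u != 0 & forall x, polar q x u = 0.
Proof.
move=> q01 qB S0; have [qBl qBr] := qB.
have [/existsP[u /andP[u0 /forallP uR]] | ] :=
    boolP [exists u : T, (u != 0) && [forall x : T, polar q x u == 0]].
  by exists u => // x; apply/eqP/uR.
rewrite negb_exists => /forallP nonrad; exfalso.
have b01 := binary_polar q01.
have : (\sum_(x : T) sign_char (q x)) * (\sum_(x : T) sign_char (q x)) = #|T|%:Z.
  rewrite mulr_suml.
  transitivity (\sum_(x : T) \sum_(u : T) sign_char (q u) * sign_char (polar q x u)).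
    apply: eq_bigr => x _; rewrite mulr_sumr (reindex_inj (addrI x)) /=.
    apply: eq_bigr => u _.
    rewrite (add_polar q) (sign_charD (binaryD (q01 x) (q01 u)) (b01 x u)).
    rewrite sign_charD // !mulrA.
    by rewrite /sign_char; case: eqP; rewrite ?mul1r ?mulrN1 ?mulN1r ?opprK.
  rewrite exchange_big (bigD1 (0 : T)) //= [X in _ + X]big1 => [|u u0].
    rewrite addr0 (biadditive_polar0 qB).
    rewrite (eq_bigr (fun=> 1)) => [|x _]; first by rewrite sumr_const natz.
    by rewrite (additive0 (qBr x)) /sign_char eqxx.
  rewrite -mulr_sumr.
  have := nonrad u; rewrite negb_and u0 /= negb_forall => /existsP[x xu].
  by rewrite (sum_sign_char_additive (qBl u) (fun z => b01 z u) xu) mulr0.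
rewrite S0 mul0r card_field.
by move/esym/eqP; rewrite eqz_nat expn_eq0.
Qed.

End Balanced.

Section BalancedComponents.
Variables (m : nat) (K : fieldExtType 'F_2) (r : nat).
Hypothesis dimK : \dim {:K} = m.+4.
Hypothesis r_gt0 : (0 < r)%N.
Hypothesis co_r : coprime r m.+4.
Local Notation n := m.+4.
Local Notation phi := (frob (K := K) r).
Local Notation g := (gold r : K -> K).
Local Notation fcoef := (@fcoef m K r).
Local Notation T := (finvect_type K).
Implicit Types (i k : 'I_n) (x y : K).

Lemma coprime_dim : coprime r (\dim {:K}).
Proof. by rewrite dimK. Qed.

(** Powers of phi run through the Galois group, so this is the absolute trace. *)
Definition trace x : K := \sum_(i < n) phi i x.

Lemma traceD : is_additive trace.
Proof. by move=> x y; rewrite /trace -big_split; apply: eq_bigr => i _; apply: frobD. Qed.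

Lemma frob_trace x : phi 1 (trace x) = trace x.
Proof.
rewrite /trace additive_sum; last exact: frobD.
by rewrite [RHS](reindex_inj (addIr 1)); apply: eq_bigr => i _; rewrite (frobS r dimK).
Qed.

Lemma trace_binary : binary trace.
Proof. by move=> x; apply: frob_fixed r_gt0 coprime_dim (frob_trace x). Qed.

Lemma trace_nondegenerate x : (forall c, trace (c * x) = 0) -> x = 0.
Proof.
move=> tr0; apply/eqP; case: eqVneq => // x0.
have := fcoef_frob_sum dimK co_r (fun=> 1) 0.
rewrite (_ : _ 0 = 0); first by move/eqP; rewrite eq_sym oner_eq0.
rewrite -[RHS](fcoef0 K r (0 : 'I_n)); apply: fcoef_ext => y.
rewrite -[RHS](tr0 (y / x)) divfK //; apply: eq_bigr => i _.
by rewrite mul1r.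
Qed.

Section Functional.
Variable C : K -> K.
Hypothesis CD : is_additive C.

Definition functional (c x : K) : K := trace (c * C x).

Lemma functionalD c : is_additive (functional c).
Proof. by move=> x y; rewrite /functional CD mulrDr traceD. Qed.

(** If d is the covector of c, then trace (c * C x) = trace (d * x): this is the
    transpose of C. *)
Definition covector (c : K) : K := fcoef (functional c) 0.

Lemma covectorD : is_additive covector.
Proof.
move=> c d; rewrite /covector -fcoefD; apply: fcoef_ext => x.
by rewrite /functional mulrDl traceD.
Qed.

Lemma fcoef_functional c i :
  fcoef (functional c) i = phi 1 (fcoef (functional c) (i - 1)).
Proof.
rewrite -(fcoef_frob_comp dimK co_r i (functionalD c)).
by apply: fcoef_ext => x; rewrite frob_trace.
Qed.

Lemma covector_eq0 c : covector c = 0 -> forall x, functional c x = 0.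
Proof.
move=> c0 x; rewrite (fcoef_expand dimK co_r (functionalD c)) big1 // => i _.
suff -> : fcoef (functional c) i = 0 by rewrite mul0r.
rewrite -[i]natr_Zp; elim: (nat_of_ord i) => // k IHk.
by rewrite fcoef_functional -natr1 addrK IHk (additive0 (frobD _ _)).
Qed.

(** An element u of the radical of the form trace (d * polar g x y) satisfies
    phi(d g(u)) = d g(u). *)
Lemma covector_gold c u : covector c != 0 -> u != 0 ->
  (forall x, functional c (polar g x u) = 0) -> covector c * g u = 1.
Proof.
move=> d0 u0 fu0.
have := fcoef_polar_gold dimK co_r 0 u (functionalD c).
have -> : phi (0 + 1 : 'I_n)%R u = phi 1 u by rewrite -(frobS r dimK) frob_0.
rewrite (fcoef_ext r _ fu0) fcoef0 => /esym/addx_eq0/(congr1 (phi 1)).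
rewrite !frobM -fcoef_functional (frobS r dimK) subrK frob_0 -/(covector c) => e.
have : phi 1 (covector c * g u) = covector c * g u.
  by rewrite goldE !frobM mulrCA e mulrCA [phi 1 u * u]mulrC.
case/(frob_fixed r_gt0 coprime_dim) => // /eqP.
by rewrite mulf_eq0 (negPf d0) goldE mulf_eq0 frob_eq0 (negPf u0).
Qed.

(** The form trace (c * (A x + C (g x))) is a component of a permutation, hence
    balanced, hence degenerate. *)
Lemma balanced_covector (A : K -> K) c :
  is_additive A -> injective (fun x => A x + C (g x)) -> covector c != 0 ->
  exists2 u, u != 0 & covector c * g u = 1.
Proof.
move=> AD pinj d0.
have c0 : c != 0.
  by apply: contraNneq d0 => ->; rewrite (additive0 covectorD).
pose p x := A x + C (g x); pose q x := trace (c * p x).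
have [gBl gBr] := biadditive_gold K r.
have qP x y : polar q x y = functional c (polar g x y).
  rewrite {1}/polar /q /functional -!traceD -!mulrDr /p AD; congr (trace (c * _)).
  rewrite (add_polar g) (CD (g x + g y)) (CD (g x)).
  transitivity (C (polar g x y) + (A x + A x) + (A y + A y)
    + (C (g x) + C (g x)) + (C (g y) + C (g y))); first by ring.
  by rewrite !addxx !addr0.
have [x0 x00] : exists x, trace (c * x) != 0.
  case: (boolP [exists x : T, trace (c * x) != 0]) => [/existsP // | ].
  rewrite negb_exists => /forallP tr0; case/eqP: c0.
  apply: trace_nondegenerate => x; apply/eqP; rewrite mulrC.
  by rewrite -[_ == _]negbK; apply: tr0.
have [||| u u0 uR] := @sum_sign_char_quadratic K q.
- by move=> x; apply: trace_binary.
- by split=> [y|x] u v /=; rewrite !qP ?gBl ?gBr functionalD.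
- rewrite -[RHS](@sum_sign_char_additive K (fun x => trace (c * x)) x0) //.
  + by rewrite [RHS](reindex_inj (pinj : injective (p : T -> T))).
  + by move=> x y; rewrite mulrDr traceD.
  + by move=> x; apply: trace_binary.
by exists u => //; apply: covector_gold => // x; rewrite -qP uR.
Qed.

End Functional.
End BalancedComponents.

Section DimensionFour.
Variables (K : fieldExtType 'F_2) (r : nat).
Hypothesis dimK : \dim {:K} = 4.
Hypothesis r_gt0 : (0 < r)%N.
Hypothesis co_r : coprime r 4.
Local Notation g := (gold r : K -> K).
Local Notation T := (finvect_type K).

Lemma gold_expr5 (u : K) : u != 0 -> g u ^+ 5 = 1.
Proof.
move=> u0.
have u15 : u ^+ 15 = 1.
  apply: (mulfI u0); rewrite -exprS mulr1.
  by have := expf_dim u; rewrite dimK.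
have [k Ek] : exists k, (2 ^ r + 1 = k * 3)%N.
  have r_odd : odd r by rewrite -coprimen2 (coprime_dvdr _ co_r).
  rewrite -[r]odd_double_half r_odd add1n; elim: r./2 => [|h [k IHk]]; first by exists 1.
  by exists (4 * k - 1)%N; rewrite doubleS 2!expnS; lia.
by rewrite /gold Ek -exprM -mulnA mulnC exprM u15 expr1n.
Qed.

(** The ratio w = x / y would satisfy w^2 = w + 1, so w^3 = 1 besides w^5 = 1. *)
Lemma fifth_roots_sum (x y : K) :
  x ^+ 5 = 1 -> y ^+ 5 = 1 -> (x + y) ^+ 5 = 1 -> False.
Proof.
move=> x5 y5 xy5.
have y0 : y != 0.
  by apply: contra_eq_neq y5 => ->; rewrite expr0n eq_sym oner_eq0.
pose w := x / y.
have w5 : w ^+ 5 = 1 by rewrite expr_div_n x5 y5 divr1.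
have w15 : (w + 1) ^+ 5 = 1.
  by rewrite /w -[X in _ + X](divff y0) -mulrDl expr_div_n xy5 y5 divr1.
have w4 : w ^+ 4 + w = 1.
  have E : (w + 1) ^+ 5 = w ^+ 5 + (w ^+ 4 + w) + 1
     + (w * (2%:R * w ^+ 3 + 5%:R * w ^+ 2 + 5%:R * w + 2%:R) +
        w * (2%:R * w ^+ 3 + 5%:R * w ^+ 2 + 5%:R * w + 2%:R)) by ring.
  by move: E; rewrite w15 w5 addxx addr0 addrAC addxx add0r.
have w2 : w ^+ 2 = w + 1.
  have : w ^+ 5 + w ^+ 2 = w by rewrite exprS -mulrDr w4 mulr1.
  by rewrite w5 => e; rewrite -{2}e addrAC addxx add0r.
have : w ^+ 4 + w = (w ^+ 2) ^+ 2 + w by rewrite -exprM.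
rewrite w4 w2; have -> : (w + 1) ^+ 2 + w = w ^+ 2 + w + 1 + (w + w) by ring.
by rewrite w2 addxx addr0 addrAC addxK addxx => /eqP; rewrite oner_eq0.
Qed.

(** All nonzero covectors are fifth roots of unity and form, with 0, a group
    under addition, so at most one of them exists. *)
Lemma dim4_balanced_rank_one (A C : K -> K) :
  is_additive A -> is_additive C -> injective (fun x => A x + C (g x)) ->
  rank_le1 C.
Proof.
move=> AD CD pinj x y Cx0 Cy0.
have d5 c : covector 0 r C c != 0 -> covector 0 r C c ^+ 5 = 1.
  move=> d0; have [u u0 du] := balanced_covector dimK r_gt0 co_r CD AD pinj d0.
  have := congr1 (fun z => z ^+ 5) du.
  by rewrite exprMn gold_expr5 // mulr1 expr1n.
have same c c' : covector 0 r C c != 0 -> covector 0 r C c' != 0 ->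
    functional 0 r C c =1 functional 0 r C c'.
  move=> d0 d'0 z; apply: addx_eq0; rewrite -traceD -mulrDl.
  apply: (covector_eq0 dimK co_r CD).
  have [// | dd'] := eqVneq (covector 0 r C (c + c')) 0.
  case: (@fifth_roots_sum (covector 0 r C c) (covector 0 r C c')); rewrite ?d5 //.
  by rewrite -covectorD d5.
have ex1 z : C z != 0 -> exists2 c, covector 0 r C c != 0 & functional 0 r C c z = 1.
  move=> Cz0.
  have [/existsP[c fc] | ] := boolP [exists c : T, functional 0 r C c z != 0].
    exists c; last first.
      have [f0 | //] := trace_binary dimK r_gt0 co_r (c * C z).
      by rewrite /functional f0 eqxx in fc.
    by apply: contraNneq fc => d0; apply/eqP/(covector_eq0 dimK co_r CD).
  rewrite negb_exists => /forallP f0; case/eqP: Cz0.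
  apply: (trace_nondegenerate dimK co_r) => c.
  by apply/eqP; rewrite -[_ == _]negbK; apply: f0.
have [cx dx fx] := ex1 x Cx0; have [cy dy fy] := ex1 y Cy0.
apply: addx_eq0; apply: (trace_nondegenerate dimK co_r) => c; rewrite -CD.
have [d0 | d0] := eqVneq (covector 0 r C c) 0; first exact: covector_eq0 d0 _.
rewrite -/(functional 0 r C c (x + y)) functionalD //.
by rewrite {1}(same c cx) // (same c cy) // fx fy addxx.
Qed.

End DimensionFour.

(** * CCZ-equivalence with the Gold function *)

Lemma affine_additive (K : fieldExtType 'F_2) (h : K -> K) (c : K) :
  is_additive h -> affine (fun x => h x + c).
Proof. by case/linear_of_additive=> L eL; exists L, c => x; rewrite eL. Qed.

Lemma injective_bijective (K : fieldExtType 'F_2) (h : K -> K) :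
  injective h -> bijective h.
Proof. exact: (@injF_bij (finvect_type K)). Qed.

(** The block matrix with rows (D, E) and (D', E') is a left inverse of the one
    with rows (A, C) and (A', C'). *)
Definition block_inverse (K : zmodType) (A C A' C' D E D' E' : K -> K) : Prop :=
  (forall x y, D (A x + C y) + E (A' x + C' y) = x) /\
  (forall x y, D' (A x + C y) + E' (A' x + C' y) = y).

(** A, C, A', C' are the blocks of the inverse of the linear part of the given
    permutation of K * K, and D, E, D', E' those of the linear part itself. *)
Lemma CCZ_blocks (K : fieldExtType 'F_2) (f g : K -> K) :
  CCZ_equivalent f g ->
  exists A C A' C' D E D' E' : K -> K, exists c1 c2 : K,
    [/\ [/\ is_additive A, is_additive C, is_additive A' & is_additive C'],
        [/\ is_additive D, is_additive E, is_additive D' & is_additive E'],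
        block_inverse A C A' C' D E D' E',
        block_inverse D E D' E' A C A' C'
      & forall x, f (A x + C (g x) + c1) = A' x + C' (g x) + c2].
Proof.
case=> P [[[L [c eP]] [Q PK QK]] im_graph].
pose L' (v : K * K) := Q (v + c).
have L'E v : L (L' v) = v.
  by apply: (addIr c); rewrite -eP QK.
have LE v : L' (L v) = v by rewrite /L' -eP PK.
have L'D u v : L' (u + v) = L' u + L' v.
  by rewrite -{1}(L'E u) -{1}(L'E v) -linearD LE.
have LD u v : L (u + v) = L u + L v by rewrite linearD.
have split_pair (M : K * K -> K * K) x y : (forall u v, M (u + v) = M u + M v) ->
    M (x, y) = ((M (x, 0)).1 + (M (0, y)).1, (M (x, 0)).2 + (M (0, y)).2).
  move=> MD; have -> : (x, y) = (x, 0) + (0, y) by congr pair; rewrite /= ?addr0 ?add0r.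
  by rewrite MD; case: (M (x, 0)) => ? ?; case: (M (0, y)).
have D1 (M : K * K -> K * K) : (forall u v, M (u + v) = M u + M v) ->
    (forall x y, M (x + y, 0) = M (x, 0) + M (y, 0)) /\
    (forall x y, M (0, x + y) = M (0, x) + M (0, y)).
  move=> MD; split=> x y; rewrite -MD; congr (M _); congr pair; by rewrite /= addr0.
have [L1 L2] := D1 _ LD; have [L'1 L'2] := D1 _ L'D.
exists (fun x => (L' (x, 0)).1), (fun y => (L' (0, y)).1),
  (fun x => (L' (x, 0)).2), (fun y => (L' (0, y)).2),
  (fun x => (L (x, 0)).1), (fun y => (L (0, y)).1),
  (fun x => (L (x, 0)).2), (fun y => (L (0, y)).2), (L' (- c)).1, (L' (- c)).2.
split.
- by split=> x y; rewrite ?L'1 ?L'2.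
- by split=> x y; rewrite ?L1 ?L2.
- have H x y : L (L' (x, y)) = (x, y) by rewrite L'E.
  by split=> x y; have := H x y; rewrite (split_pair L') // (split_pair L) // => -[].
- have H x y : L' (L (x, y)) = (x, y) by rewrite LE.
  by split=> x y; have := H x y; rewrite (split_pair L) // (split_pair L') // => -[].
move=> x; have : (x, g x) \in graph g by apply/imsetP; exists x.
rewrite -im_graph => /imsetP[_ /imsetP[y _ ->]] /= exy.
have : (y, f y) = L' (x, g x) + L' (- c).
  by rewrite -L'D exy /L' subrK PK.
by rewrite (split_pair L') // => -[{1}-> ->].
Qed.

(** If C = 0 then A is injective and E = 0, so that E' is the inverse of C'. *)
Lemma EA_of_no_mixing (K : fieldExtType 'F_2) (f g A C A' C' D E D' E' : K -> K)
    (c1 c2 : K) :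
    is_additive A -> is_additive A' -> is_additive C' ->
    is_additive D -> is_additive D' -> is_additive E' ->
    block_inverse A C A' C' D E D' E' -> block_inverse D E D' E' A C A' C' ->
    (forall x, f (A x + C (g x) + c1) = A' x + C' (g x) + c2) ->
    injective (fun x => A x + C (g x) + c1) -> (forall y, C y = 0) ->
  EA_equivalent f g.
Proof.
move=> AD A'D C'D DD D'D E'D [inv1 inv2] [inv3 inv4] fpi pinj C0.
have Ainj : injective A.
  by move=> x y eA; apply: pinj; rewrite /= eA !C0.
have E0 y : E y = 0.
  apply: Ainj; rewrite (additive0 AD).
  by have := inv3 0 y; rewrite C0 addr0 (additive0 DD) add0r.
have E'inj : injective E'.
  apply: (additive_inj E'D) => y E'y.
  by have := inv4 0 y; rewrite (additive0 DD) E0 E'y (additive0 D'D) !addr0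
    (additive0 A'D) (additive0 C'D) addr0.
exists E', (fun x => A x + c1), (fun x => D' (A x) + E' c2); split.
- split; last exact: injective_bijective.
  have [L eL] := linear_of_additive E'D.
  by exists L, 0 => x; rewrite addr0 eL.
- split; first exact: affine_additive.
  by apply: injective_bijective => x y /addIr/Ainj.
- by apply: (affine_additive (h := fun x => D' (A x))) => x y; rewrite AD D'D.
move=> x; have := inv2 x (g x); have := fpi x.
rewrite !C0 !addr0 => -> e; rewrite -{1}e.
rewrite (E'D _ c2) -[LHS]addr0 -(addxx (E' c2)); ring.
Qed.

(** * Translations of the quadratic function, acting on the Gold graph *)

Section Translations.
Variables (m : nat) (K : fieldExtType 'F_2) (r : nat).
Hypothesis dimK : \dim {:K} = m.+4.
Hypothesis r_gt0 : (0 < r)%N.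
Hypothesis co_r : coprime r m.+4.
Local Notation n := m.+4.
Local Notation phi := (frob (K := K) r).
Local Notation g := (gold r : K -> K).
Local Notation T := (finvect_type K).
Variables (f A C A' C' D E D' E' : K -> K) (c1 c2 : K).
Hypotheses (fB : biadditive (polar f)) (fan : anisotropic (polar f)).
Hypotheses (AD : is_additive A) (CD : is_additive C).
Hypotheses (A'D : is_additive A') (C'D : is_additive C').
Hypotheses (DD : is_additive D) (ED : is_additive E).
Hypotheses (D'D : is_additive D') (E'D : is_additive E').
Hypothesis inv12 : block_inverse A C A' C' D E D' E'.
Hypothesis fpi : forall x, f (A x + C (g x) + c1) = A' x + C' (g x) + c2.

Definition new_coord (x : K) : K := A x + C (g x) + c1.
Local Notation pi := new_coord.

Lemma new_coordK x : D (pi x + c1) + E (f (pi x) + c2) = x.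
Proof. by rewrite fpi !addxK; case: inv12 => ->. Qed.

Lemma new_coord_gold x : D' (pi x + c1) + E' (f (pi x) + c2) = g x.
Proof. by rewrite fpi !addxK; case: inv12 => _ ->. Qed.

Lemma new_coord_inj : injective pi.
Proof. by move=> x y exy; rewrite -(new_coordK x) exy new_coordK. Qed.

(** The translation by a of the graph of f,
    (X, Y) |-> (X + a, Y + f(a) + polar f X a), conjugated by the permutation
    that carries this graph to the graph of g, maps (x, y) to the pair of
    lin_part a x + mix_part a y + shift_part a and
    gold_lin_part a x + gold_mix_part a y + gold_shift_part a. *)
Definition lin_part (a x : K) : K := x + E (polar f (A x) a).
Definition mix_part (a y : K) : K := E (polar f (C y) a).
Definition shift_part (a : K) : K := D a + E (f a + polar f c1 a).
Definition gold_lin_part (a x : K) : K := E' (polar f (A x) a).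
Definition gold_mix_part (a y : K) : K := y + E' (polar f (C y) a).
Definition gold_shift_part (a : K) : K := D' a + E' (f a + polar f c1 a).
Definition trans (a x : K) : K := lin_part a x + mix_part a (g x) + shift_part a.

Lemma lin_partD a : is_additive (lin_part a).
Proof. by move=> x y; rewrite /lin_part AD fB.1 ED; ring. Qed.

Lemma mix_partD a : is_additive (mix_part a).
Proof. by move=> x y; rewrite /mix_part CD fB.1 ED. Qed.

Lemma gold_lin_partD a : is_additive (gold_lin_part a).
Proof. by move=> x y; rewrite /gold_lin_part AD fB.1 E'D. Qed.

Lemma gold_mix_partD a : is_additive (gold_mix_part a).
Proof. by move=> x y; rewrite /gold_mix_part CD fB.1 E'D; ring. Qed.

Lemma graph_translation (D0 E0 : K -> K) a x : is_additive D0 -> is_additive E0 ->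
  D0 (pi x + a + c1) + E0 (f (pi x + a) + c2) =
  D0 (pi x + c1) + E0 (f (pi x) + c2) + E0 (polar f (A x) a) +
  E0 (polar f (C (g x)) a) + (D0 a + E0 (f a + polar f c1 a)).
Proof.
move=> D0D E0D.
have fE : f (pi x + a) = f (pi x) + f a +
    (polar f (A x) a + polar f (C (g x)) a + polar f c1 a).
  by rewrite (add_polar f) /new_coord !fB.1.
rewrite fE; move: (pi x) (polar f) => p B.
by rewrite !D0D !E0D; ring.
Qed.

Lemma new_coord_trans a x : pi (trans a x) = pi x + a.
Proof.
have [y ey] : exists y, pi y = pi x + a.
  have [pi' _ piK] := injective_bijective new_coord_inj.
  by exists (pi' (pi x + a)); rewrite piK.
rewrite -ey; congr pi; rewrite -[RHS]new_coordK ey graph_translation // new_coordK.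
by rewrite /trans /lin_part.
Qed.

Lemma trans_inj a : injective (trans a).
Proof.
move=> x y /(congr1 pi); rewrite !new_coord_trans.
by move/addIr/new_coord_inj.
Qed.

Lemma gold_trans a x : g (trans a x) =
  gold_lin_part a x + gold_mix_part a (g x) + gold_shift_part a.
Proof.
rewrite -[LHS]new_coord_gold new_coord_trans graph_translation // new_coord_gold.
by rewrite /gold_lin_part /gold_mix_part [E' _ + (g x + _)]addrCA addrA.
Qed.

Section LargeDimension.
Hypothesis m_gt0 : (0 < m)%N.

Let co_dim : coprime r (\dim {:K}).
Proof. by rewrite dimK. Qed.

(** The linear part (X, Y) |-> (X, Y + polar f X a) of the translation by a is
    the identity where X is 0 or a, as polar f is alternating; and C takes one
    of these values at some y != 0, being surjective if it is injective. *)
Lemma mix_part_not_injective a : a != 0 -> exists2 y, y != 0 & mix_part a y = 0.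
Proof.
move=> a0.
have [/existsP[y /andP[y0 Cy]] | ] :=
    boolP [exists y : T, (y != 0) && ((C y == 0) || (C y == a))].
  exists y => //; rewrite /mix_part; case/orP: Cy => /eqP->.
    by rewrite (additive0 (fB.1 a)) (additive0 ED).
  by rewrite polarxx // (additive0 ED).
rewrite negb_exists => /forallP noy; exfalso.
have Cinj : injective C.
  apply: (additive_inj CD) => y Cy; apply/eqP; have := noy y.
  by rewrite Cy eqxx andbT negbK.
have [C1 _ CK] := injective_bijective Cinj.
have := noy (C1 a); rewrite CK eqxx orbT andbT negbK => /eqP C10.
by move: (CK a); rewrite C10 (additive0 CD) => /eqP; rewrite eq_sym (negPf a0).
Qed.

Lemma mix_part_eq0 a y : mix_part a y = 0.
Proof.
have [-> | a0] := eqVneq a 0.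
  by rewrite /mix_part (additive0 (fB.2 _)) (additive0 ED).
have gt x : g (lin_part a x + mix_part a (g x) + shift_part a) = _ := gold_trans a x.
have par := quartic_parallel dimK co_r m_gt0 (mix_partD a)
  (gold_automorphism_quartic (lin_partD a) (mix_partD a)
     (gold_lin_partD a) (gold_mix_partD a) gt).
have [[s [c mono]] | rk1] := monomial_or_rank_one dimK r_gt0 co_r m_gt0 (mix_partD a) par.
  have [z z0] := mix_part_not_injective a0.
  move/eqP; rewrite !mono mulf_eq0 frob_eq0 (negPf z0) orbF => /eqP ->.
  by rewrite mul0r.
apply: (rank_one_gold_zero dimK co_r (biadditive_gold K r)
  (anisotropic_gold r_gt0 co_dim) (lin_partD a) (mix_partD a) rk1 (@trans_inj a)).
move=> u v w; rewrite -[RHS](quadratic_third_difference r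
  (gold_shift_part a) (gold_lin_partD a) (gold_mix_partD a) u v w).
by rewrite /third_difference !gt.
Qed.

Lemma transE a x : trans a x = lin_part a x + shift_part a.
Proof. by rewrite /trans mix_part_eq0 addr0. Qed.

Lemma lin_part_inj a : injective (lin_part a).
Proof. by move=> x y exy; apply: (@trans_inj a); rewrite !transE exy. Qed.

(** Rank one is impossible here since lin_part a is injective. *)
Lemma lin_part_monomial a : exists (s : 'I_n) c, forall x, lin_part a x = c * phi s x.
Proof.
have gt x : g (lin_part a x + mix_part a (g x) + shift_part a) = _ := gold_trans a x.
have [] // := monomial_or_rank_one dimK r_gt0 co_r m_gt0 (lin_partD a).
  apply: (polar_gold_image_parallel dimK co_r (lin_partD a) (gold_mix_partD a)) => x y.
  exact: (gold_automorphism_polar (lin_partD a) (gold_lin_partD a)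
    (gold_mix_partD a) gt _ _ (mix_part_eq0 a)).
move=> rk1.
have [y y0 y1] : exists2 y : K, y != 0 & y != 1.
  have [/existsP[y /andP[y0 y1]] | ] := boolP [exists y : T, (y != 0) && (y != 1)].
    by exists y.
  rewrite negb_exists => /forallP no_y; exfalso.
  suff : (#|T| <= 2)%N by rewrite card_field dimK (@leq_exp2l 2 _ 1).
  apply: (@leq_trans #|[set (0 : T); 1]|); last by rewrite cards2; case: eqP.
  rewrite -cardsT; apply: subset_leq_card; apply/subsetP => z _.
  by have := no_y z; rewrite !inE negb_and !negbK.
have lin0 z : z != 0 -> lin_part a z != 0.
  by apply: contra_neq => z0; apply: (@lin_part_inj a); rewrite z0 (additive0 (lin_partD a)).
have := rk1 y 1 (lin0 _ y0) (lin0 _ (oner_neq0 _)) => /lin_part_inj e1.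
by rewrite e1 eqxx in y1.
Qed.

Lemma lin_part_involutive a x : lin_part a (lin_part a x) = x.
Proof.
have tt u : trans a (trans a u) = u.
  by apply: new_coord_inj; rewrite !new_coord_trans addxK.
have := tt x; have := tt 0; rewrite !transE (additive0 (lin_partD a)) add0r => e0.
by rewrite (lin_partD a _ (shift_part a)) -addrA e0 addr0.
Qed.

(** In the scalar case s = 0, the involution forces c^2 = 1, so c = 1. *)
Lemma lin_part_frob a : (forall x, lin_part a x = x) \/
  exists (s : 'I_n) c, s != 0 /\ forall x, lin_part a x = c * phi s x.
Proof.
have [s [c Ma]] := lin_part_monomial a.
have [s0 | s0] := eqVneq s 0; last by right; exists s, c.
left => x; have := lin_part_involutive a 1.
rewrite !Ma s0 !frob_0 mulr1 -expr2 => c2_1.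
suff -> : c = 1 by rewrite mul1r.
have /eqP : (c - 1) * (c + 1) = 0 by rewrite -subr_sqr expr1n c2_1 subrr.
by rewrite mulf_eq0 subr_eq0 addr_eq0 oppx orbb => /eqP.
Qed.

(** As lin_part a + id is additive in a, three monomials satisfy
    e phi^v = c phi^s + d phi^t + id. With s and t nonzero, the coefficient of id
    on the right is 1. *)
Lemma lin_part_index2 a b :
  (forall x, lin_part a x = x) \/ (forall x, lin_part b x = x) \/
  (forall x, lin_part (a + b) x = x).
Proof.
have [| [s [c [s0 Ma]]]] := lin_part_frob a; first by left.
have [| [t [d [t0 Mb]]]] := lin_part_frob b; first by right; left.
right; right; have [v [e Mab]] := lin_part_monomial (a + b).
have sum x : e * phi v x = c * phi s x + d * phi t x + phi (0 : 'I_n)%R x.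
  rewrite frob_0 -Ma -Mb -Mab /lin_part (fB.2 (A x)) ED.
  move: (E (polar f _ a)) (E (polar f _ b)) => u w; rewrite -[LHS]addr0 -(addxx x); ring.
have := fcoef_ext r (0 : 'I_n) sum.
rewrite !fcoefD !fcoefMl !(fcoef_frob dimK co_r) ![0 == _]eq_sym (negPf s0) (negPf t0).
rewrite eqxx !mulr0 !add0r; case: eqP => [v0 | _]; last first.
  by rewrite mulr0 => /eqP; rewrite eq_sym oner_eq0.
by rewrite mulr1 => e1 x; rewrite Mab v0 e1 mul1r frob_0.
Qed.

(** Here trans a is the translation by w = shift_part a, along which pi changes
    by the constant a; all of its increment at x except C (polar g x w) is
    independent of x. *)
Lemma unmixed_translation a x :
  (forall x, lin_part a x = x) -> C (polar g x (shift_part a)) = 0.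
Proof.
move=> Ma.
have eq u : A (shift_part a) + C (g (shift_part a)) + C (polar g u (shift_part a)) = a.
  have := new_coord_trans a u; rewrite transE Ma /new_coord AD (add_polar g).
  rewrite (CD _ (polar g _ _)) (CD (g u)) => e.
  apply: (addrI (A u + C (g u) + c1)); rewrite -e; ring.
have := eq x; rewrite -[RHS](eq 0) => /addrI ->.
by rewrite (additive0 ((biadditive_gold K r).1 _)) (additive0 CD).
Qed.

(** Put a = pi(x) + pi(0) and b = pi(y) + pi(0), so that x and y are the shifts
    of the translations by a and b. If neither of these has trivial linear part,
    the translation by a + b does, and it maps y to x; so x = y + w with w its
    shift, and polar g x y = polar g w y. *)
Lemma no_mixing y : C y = 0.
Proof.
apply: (polar_gold_separates dimK co_r CD) => {y} x y.
have shiftE u : shift_part (pi u + pi 0) = u.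
  rewrite -[LHS]add0r -{1}(additive0 (lin_partD (pi u + pi 0))) -transE.
  by apply: new_coord_inj; rewrite new_coord_trans addrCA addxx addr0.
have [M1 | [M1 | M1]] := lin_part_index2 (pi x + pi 0) (pi y + pi 0).
- by rewrite polarC -{1}(shiftE x) unmixed_translation.
- by rewrite -{1}(shiftE y) unmixed_translation.
move: M1; set w := _ + _ + _ => M1.
have ex : x = y + shift_part w.
  rewrite -{1}(M1 y) -transE; apply: new_coord_inj; rewrite new_coord_trans /w.
  move: (pi x) (pi y) (pi 0) => p q o.
  rewrite -[LHS]addr0 -(addxx q) -[LHS]addr0 -(addxx o); ring.
rewrite {1}ex (biadditive_gold K r).1 polarxx; last exact: biadditive_gold.
by rewrite add0r polarC unmixed_translation.
Qed.

End LargeDimension.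

Lemma no_mixing_dim4 : m = 0 -> forall y, C y = 0.
Proof.
move=> m0; have dim4 : \dim {:K} = 4 by rewrite dimK m0.
have co4 : coprime r 4 by move: co_r; rewrite m0.
have pinj : injective (fun x => A x + C (g x)).
  by move=> x y exy; apply: new_coord_inj; rewrite /new_coord exy.
have rk1 := dim4_balanced_rank_one dim4 r_gt0 co4 AD CD pinj.
apply: (rank_one_gold_zero dimK co_r fB fan AD CD rk1 new_coord_inj) => u v w.
rewrite -[RHS](quadratic_third_difference r c2 A'D C'D u v w).
by rewrite /third_difference !fpi.
Qed.

End Translations.

(** * Dimension at most three *)

Section SmallDimension.
Variable K : fieldExtType 'F_2.
Local Notation T := (finvect_type K).

(** The sum of S f and g has zero polar form, so it is additive. *)
Lemma EA_of_polar (f g S : K -> K) :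
    biadditive (polar f) -> biadditive (polar g) ->
    is_additive S -> injective S ->
    (forall x y, S (polar f x y) = polar g x y) ->
  EA_equivalent f g.
Proof.
move=> fB gB SD Sinj SP.
have AD : is_additive (fun x => S (f x) + g x).
  move=> x y; rewrite (add_polar f) (add_polar g) -SP SD (SD (f x)).
  move: (S (polar f x y)) => u.
  rewrite -[RHS]addr0 -(addxx u); ring.
have id_aff : affine_permutation (fun x : K => x).
  split; last by exists id.
  have [L eL] := @linear_of_additive K (fun x => x) (fun _ _ => erefl).
  by exists L, 0 => x; rewrite eL addr0.
exists S, (fun x => x), (fun x => S (f x) + g x); split => //.
- split; last exact: injective_bijective.
  by have [L eL] := linear_of_additive SD; exists L, 0 => x; rewrite eL addr0.
- by have [L eL] := linear_of_additive AD; exists L, 0 => x; rewrite eL addr0.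
by move=> x; rewrite addrA addxx add0r.
Qed.

Lemma basis_change (n : nat) (X Y : n.-tuple K) :
  \dim {:K} = n -> free X -> free Y ->
  exists2 S : K -> K, is_additive S & injective S /\ forall i : 'I_n, S X`_i = Y`_i.
Proof.
move=> dimn Xfree Yfree.
have XB v : v = \sum_i coord X i v *: X`_i.
  apply: (coord_basis _ (memvf v)).
  by rewrite basisEfree Xfree subvf size_tuple dimn leqnn.
pose S v := \sum_i coord X i v *: Y`_i.
have SD : is_additive S.
  move=> u v; rewrite /S -big_split; apply: eq_bigr => i _.
  by rewrite linearD scalerDl.
exists S => //; split.
  apply: (additive_inj SD) => v /(elimT freeP Yfree) v0; rewrite (XB v) big1 // => i _.
  by rewrite v0 scale0r.
move=> i; rewrite /S (bigD1 i) //= coord_free // eqxx scale1r big1 ?addr0 // => j ji.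
by rewrite coord_free // eq_sym (negPf ji) scale0r.
Qed.

Lemma alternating_basis_eq0 (B : K -> K -> K) :
  biadditive B -> 
  (forall i j, (i < \dim {:K})%N -> (j < \dim {:K})%N ->
     B (vbasis {:K})`_i (vbasis {:K})`_j = 0) ->
  forall x y, B x y = 0.
Proof.
move=> [BDl BDr] B0 x y.
have zD : is_additive (fun _ : K => 0 : K) by move=> ? ?; rewrite addr0.
apply: (additive_vbasis_eq (BDl y) zD) => i lti.
by apply: (additive_vbasis_eq (BDr _) zD) => j ltj; apply: B0.
Qed.

(** The two sides differ by an alternating form, which is determined by its
    values at pairs of basis vectors. *)
Lemma polar_transfer (f g S : K -> K) (s : seq K) :
    biadditive (polar f) -> biadditive (polar g) -> is_additive S ->
    vbasis {:K} = s :> seq K ->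
    (forall i j, (i < j < size s)%N ->
       S (polar f s`_i s`_j) = polar g s`_i s`_j) ->
  forall x y, S (polar f x y) = polar g x y.
Proof.
move=> fB gB SD es Ss x y; apply: addx_eq0.
have dimE : \dim {:K} = size s by rewrite -es size_tuple.
pose B x y := S (polar f x y) + polar g x y.
have BB : biadditive B.
  by split=> [v|v] u w; rewrite /B ?fB.1 ?gB.1 ?fB.2 ?gB.2 SD; ring.
apply: (alternating_basis_eq0 BB) => i j lti ltj.
rewrite es /B; rewrite dimE in lti ltj; case: (ltngtP i j) => [lij | lji | <-].
- by rewrite Ss ?lij // addxx.
- by rewrite !(polarC _ s`_i) Ss ?lji // addxx.
- by rewrite !polarxx // (additive0 SD) addr0.
Qed.

(** In dimension 3 every bivector is decomposable, so a linear relation between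
    the three values would be a zero of the polar form at independent vectors. *)
Lemma anisotropic_free3 (f : K -> K) (e0 e1 e2 : K) :
  biadditive (polar f) -> anisotropic (polar f) -> free [:: e0; e1; e2] ->
  free [:: polar f e0 e1; polar f e0 e2; polar f e1 e2].
Proof.
move=> fB fan fr.
have indep (a b c : 'F_2) : a *: e0 + b *: e1 + c *: e2 = 0 ->
    [/\ a = 0, b = 0 & c = 0].
  move=> abc; have := elimT (@freeP _ _ _ [tuple e0; e1; e2]) fr (tnth [tuple a; b; c]).
  rewrite !big_ord_recl big_ord0 addr0 addrA => /(_ abc) k0.
  by split; [apply: (k0 0) | apply: (k0 1) | apply: (k0 (2%:R))].
have nz (a b c : 'F_2) (u : K) : u = a *: e0 + b *: e1 + c *: e2 ->
    [|| a != 0, b != 0 | c != 0] -> u = 0 -> False.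
  by move=> -> abc0 /indep[a0 b0 c0]; move: abc0; rewrite a0 b0 c0.
have n0 : e0 = 0 -> False by apply: (nz 1 0 0); rewrite ?scale1r ?scale0r ?addr0.
have n1 : e1 = 0 -> False by apply: (nz 0 1 0); rewrite ?scale1r ?scale0r ?addr0 ?add0r.
have n2 : e2 = 0 -> False by apply: (nz 0 0 1); rewrite ?scale1r ?scale0r ?addr0 ?add0r.
have n01 : e0 + e1 = 0 -> False.
  by apply: (nz 1 1 0); rewrite ?scale1r ?scale0r ?addr0 ?add0r.
have n02 : e0 + e2 = 0 -> False.
  by apply: (nz 1 0 1); rewrite ?scale1r ?scale0r ?addr0 ?add0r.
have n12 : e1 + e2 = 0 -> False.
  by apply: (nz 0 1 1); rewrite ?scale1r ?scale0r ?addr0 ?add0r.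
have n012 : e0 + e1 + e2 = 0 -> False.
  by apply: (nz 1 1 1); rewrite ?scale1r.
have [fBl fBr] := fB.
have pure u v : (u = 0 -> False) -> (v = 0 -> False) -> (u + v = 0 -> False) ->
    polar f u v = 0 -> False.
  by move=> u0 v0 uv /fan[//|//|euv]; apply: uv; rewrite euv addxx.
have wedge (a b c : 'F_2) :
    a *: polar f e0 e1 + (b *: polar f e0 e2 + c *: polar f e1 e2) = 0 ->
    [/\ a = 0, b = 0 & c = 0].
  case: (F2_cases a) => ->; case: (F2_cases b) => ->; case: (F2_cases c) => ->;
    rewrite ?scale1r ?scale0r ?addr0 ?add0r => // e; exfalso; move: e.
  - exact: pure.
  - exact: pure.
  - by rewrite -fBl; apply: pure => //.
  - exact: pure.
  - rewrite polarC -fBr; apply: pure => //.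
    by rewrite addrA [e1 + e0]addrC.
  - by rewrite -fBr; apply: pure => //; rewrite addrA.
  have -> : polar f e0 e1 + (polar f e0 e2 + polar f e1 e2) = polar f (e0 + e2) (e1 + e2).
    by rewrite fBl !fBr (polarxx _ fB) addr0 (polarC f e2 e1) addrA.
  by apply: pure => //; rewrite addrACA addxx addr0.
apply/(@freeP _ _ _ [tuple polar f e0 e1; polar f e0 e2; polar f e1 e2]) => k.
rewrite !big_ord_recl big_ord0 addr0 /= => /wedge[k0 k1 k2] [[|[|[|i]]]] // lti.
- by rewrite -[RHS]k0; congr k; apply: val_inj.
- by rewrite -[RHS]k1; congr k; apply: val_inj.
- by rewrite -[RHS]k2; congr k; apply: val_inj.
Qed.

(** In dimension 2 the polar forms have a single value on the basis, and a
    multiplication carries one to the other; in dimension 3 their three values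
    are bases of K. *)
Lemma EA_small_dim (f g : K -> K) : (\dim {:K} <= 3)%N ->
  biadditive (polar f) -> anisotropic (polar f) ->
  biadditive (polar g) -> anisotropic (polar g) -> EA_equivalent f g.
Proof.
move=> n3 fB fan gB gan.
case es: (tval (vbasis {:K})) (size_tuple (vbasis {:K})) (basis_free (vbasisP {:K}))
  => [|e0 [|e1 [|e2 [|e3 s]]]] dimE fr.
- have idD : is_additive (fun x : K => x) by [].
  apply: (EA_of_polar fB gB idD) => //.
  by apply: (polar_transfer fB gB idD es) => i j; rewrite ltn0 andbF.
- have idD : is_additive (fun x : K => x) by [].
  apply: (EA_of_polar fB gB idD) => //.
  by apply: (polar_transfer fB gB idD es) => i [|j]; rewrite /= ?andbF.
- have indep h : anisotropic (polar h) -> polar h e0 e1 != 0.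
    move=> han; apply/eqP => /han; move: fr; rewrite free_cons span_seq1 seq1_free.
    case/andP=> e01 e10 [e00 | e10' | e0e1].
    + by rewrite e00 mem0v in e01.
    + by rewrite e10' eqxx in e10.
    + by rewrite e0e1 memv_line in e01.
  pose k := polar g e0 e1 / polar f e0 e1.
  have kD : is_additive (fun x => k * x) by move=> x y; rewrite mulrDr.
  have k0 : k != 0 by rewrite mulf_neq0 ?invr_eq0 ?indep.
  apply: (EA_of_polar fB gB kD); first exact: mulfI.
  apply: (polar_transfer fB gB kD es) => [[|[|i]]] [|[|j]];
    rewrite /= ?andbF // => _.
  by rewrite divfK ?indep.
- have [S SD [Sinj SE]] := @basis_change 3
    [tuple polar f e0 e1; polar f e0 e2; polar f e1 e2]
    [tuple polar g e0 e1; polar g e0 e2; polar g e1 e2] (esym dimE)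
    (anisotropic_free3 fB fan fr) (anisotropic_free3 gB gan fr).
  apply: (EA_of_polar fB gB SD Sinj).
  apply: (polar_transfer fB gB SD es) => [[|[|[|i]]]] [|[|[|j]]];
    rewrite /= ?andbF // => _.
  + exact: (SE 0).
  + exact: (SE 1).
  + exact: (SE 2%:R).
by move: n3; rewrite -dimE.
Qed.

End SmallDimension.

Theorem theorem3 (n : nat) (n_ge1 : (1 <= n)%N)
    (K : fieldExtType 'F_2) (dimK : \dim {:K} = n)
    (f : K -> K) (f_quadratic : quadratic f) (f_apn : apn f)
    (r : nat) (r_gt0 : (0 < r)%N) (r_n_coprime : gcdn r n = 1%N) :
  CCZ_equivalent f (gold r) -> EA_equivalent f (gold r).
Proof.
have fB := quadratic_polar f_quadratic.
have fan := apn_anisotropic f_quadratic f_apn.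
have co_r : coprime r n by apply/eqP.
have gB := biadditive_gold K r.
have gan : anisotropic (polar (gold r : K -> K)).
  by apply: anisotropic_gold; rewrite ?dimK.
case: (leqP n 3) => [n_le3 _ | n_gt3].
  by apply: EA_small_dim; rewrite ?dimK.
case/CCZ_blocks => A [C [A' [C' [D [E [D' [E' [c1 [c2 blocks]]]]]]]]].
case: blocks => [[AD CD A'D C'D] [DD ED D'D E'D] inv12 inv34 fpi].
have [m def_n] : exists m, n = m.+4 by exists (n - 4)%N; lia.
rewrite def_n in dimK co_r.
have pinj := new_coord_inj inv12 fpi.
apply: (EA_of_no_mixing AD A'D C'D DD D'D E'D inv12 inv34 fpi pinj).
have [m0 | m_gt0] := posnP m.
  exact: (no_mixing_dim4 dimK r_gt0 co_r fB fan AD CD A'D C'D inv12 fpi m0).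
exact: (no_mixing dimK r_gt0 co_r fB AD CD DD ED D'D E'D inv12 fpi m_gt0).
Qed.
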